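(* Let $0<\alpha\le\infty$. Assume that $n\ge2$ and $f\in S_{\mathrm{conv}}^{(n)}(-\alpha,\alpha)$ with $f'(0)\ge0$. For every $A,B\ge0$ in $M_n(\mathbb{R})$ with $\|A\|,\|B\|<\alpha$, $$s(f[A]-f[B])\prec_wf^{[1]}(\lambda(A),\lambda(B))\circ s(A-B),$$ where $f^{[1]}(\lambda(A),\lambda(B)):=\bigl(f^{[1]}(\lambda_1(A),\lambda_1(B)),\dots,f^{[1]}(\lambda_n(A),\lambda_n(B))\bigr)$.
   Context: For a real function $f$ on $(-\alpha,\alpha)$ and a real matrix $A=[a_{ij}]$ with all entries in $(-\alpha,\alpha)$, $f[A]:=[f(a_{ij})]$. For real symmetric matrices, $A\ge0$ means positive semidefinite, and $A\ge B$ means $A-B\ge0$. $\|A\|$ is the operator norm. $S_{\mathrm{conv}}^{(n)}(-\alpha,\alpha)$ is the set of real functions $f$ on $(-\alpha,\alpha)$ such that $A\ge B\ge0$ implies $f[\lambda A+(1-\lambda)B]\le\lambda f[A]+(1-\lambda)f[B]$ for all $0\le\lambda\le1$, for all symmetric $A,B\in M_n(\mathbb{R})$ with entries in $(-\alpha,\alpha)$; for $n\ge2$ every such $f$ is continuously differentiable on $(-\alpha,\alpha)$. For differentiable $f$, the divided difference is $f^{[1]}(a,b):=\frac{f(a)-f(b)}{a-b}$ if $a\ne b$ and $f^{[1]}(a,a):=f'(a)$. $\lambda(X)=(\lambda_1(X),\dots,\lambda_n(X))$ denotes the eigenvalues of a Hermitian matrix $X$ in decreasing order, and $s(X)=(s_1(X),\dots,s_n(X))$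 the singular values of $X$ in decreasing order (with multiplicity). For vectors, $\mathbf{a}\circ\mathbf{b}:=(a_1b_1,\dots,a_nb_n)$. For real $n$-vectors, $\mathbf{a}\prec_w\mathbf{b}$ means $\sum_{i=1}^ka_{[i]}\le\sum_{i=1}^kb_{[i]}$ for $1\le k\le n$, where $(a_{[i]})$, $(b_{[i]})$ are the decreasing rearrangements of the coordinates. *)

(* Defs.v *)
From mathcomp Require Import all_boot all_order all_algebra.
From mathcomp Require Import all_classical all_reals all_analysis.
From mathcomp Require Import complex.

Set Implicit Arguments.
Unset Strict Implicit.
Unset Printing Implicit Defensive.

Import Order.TTheory GRing.Theory Num.Theory.
Import numFieldNormedType.Exports.

Local Open Scope classical_set_scope.
Local Open Scope ring_scope.

(* [alpha] is an extended real, so that the interval may be the whole line.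
   A function on (-alpha, alpha) is a total [f : R -> R]; its values outside
   the interval are never used. *)
Definition in_itv (R : realType) (alpha : \bar R) (x : R) : Prop :=
  ((- alpha < x%:E) && (x%:E < alpha))%E.

Definition symmx (R : realType) (n : nat) (A : 'M[R]_n) : Prop := A^T = A.

Definition psdmx (R : realType) (n : nat) (A : 'M[R]_n) : Prop :=
  symmx A /\ forall x : 'cV[R]_n, 0 <= (x^T *m A *m x) 0 0.

Definition loewner_le (R : realType) (n : nat) (B A : 'M[R]_n) : Prop :=
  psdmx (A - B).

Definition Sconv (R : realType) (n : nat) (alpha : \bar R) (f : R -> R) : Prop :=
  forall A B : 'M[R]_n, symmx A -> symmx B ->
    (forall i j, in_itv alpha (A i j)) -> (forall i j, in_itv alpha (B i j)) ->
    loewner_le B A -> loewner_le 0 B ->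
    forall t : R, 0 <= t <= 1 ->
    loewner_le (map_mx f (t *: A + (1 - t) *: B))
               (t *: map_mx f A + (1 - t) *: map_mx f B).

Definition norm2 (R : realType) (n : nat) (x : 'cV[R]_n) : R :=
  Num.sqrt (\sum_i x i 0 ^+ 2).

Definition opnorm (R : realType) (n : nat) (A : 'M[R]_n) : R :=
  sup [set norm2 (A *m x) | x in [set x : 'cV[R]_n | norm2 x <= 1]].

(* The unique decreasing list of the roots of the characteristic polynomial,
   repeated according to multiplicity. It exists as soon as the characteristic
   polynomial splits over R, in particular when A is symmetric (see
   [eigvals_symP]); the default value 0 is only taken otherwise. *)
Definition eigvals (R : realType) (n : nat) (A : 'M[R]_n) : n.-tuple R :=
  xget [tuple 0 | i < n]
    [set s : n.-tuple R | sorted >=%R s /\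
       char_poly A = \prod_(x <- s) ('X - x%:P)].

Definition singvals (R : realType) (n : nat) (X : 'M[R]_n) : n.-tuple R :=
  [tuple Num.sqrt (tnth (eigvals (X^T *m X)) i) | i < n].

Definition divdiff (R : realType) (f : R -> R) (a b : R) : R :=
  if a == b then f^`()%classic a else (f a - f b) / (a - b).

Definition divdiff_tuple (R : realType) (f : R -> R) (n : nat)
    (a b : n.-tuple R) : n.-tuple R :=
  [tuple divdiff f (tnth a i) (tnth b i) | i < n].

Definition hadamard (R : realType) (n : nat) (a b : n.-tuple R) : n.-tuple R :=
  [tuple tnth a i * tnth b i | i < n].

Definition weakmaj (R : realType) (n : nat) (a b : n.-tuple R) : Prop :=
  forall k : nat, (1 <= k <= n)%N ->
    \sum_(i < k) (sort >=%R a)`_i <= \sum_(i < k) (sort >=%R b)`_i.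

Local Open Scope complex_scope.

Lemma eigvals_symP (R : realType) (n : nat) (A : 'M[R]_n) : symmx A ->
  sorted >=%R (eigvals A) /\
  char_poly A = \prod_(x <- eigvals A) ('X - x%:P).
Proof.
move=> symA.
suff [s sP] : exists s : n.-tuple R, sorted >=%R s /\
    char_poly A = \prod_(x <- s) ('X - x%:P).
  pose P := [set t : n.-tuple R | sorted >=%R t /\
    char_poly A = \prod_(x <- t) ('X - x%:P)].
  by have : P (eigvals A) by apply: xgetPex; exists s.
pose j := real_complex R; pose Ac := map_mx j A.
have herm : Ac \is hermsymmx.
  apply/is_hermitianmxP; rewrite scale1r; apply/matrixP => a b.
  by rewrite !mxE -{1}symA mxE -[RHS]/((_)^*)%C /= oppr0.
have /orthomx_spectralP spec := hermitian_normalmx herm.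
pose d := spectral_diag Ac.
have chE : char_poly Ac = \prod_(i < n) ('X - (d 0 i)%:P).
  have PU := spectral_unit Ac.
  have diagE : char_poly (diag_mx d) = \prod_(i < n) ('X - (d 0 i)%:P).
    rewrite char_poly_trig; first by apply: eq_bigr => i _; rewrite mxE eqxx.
    by rewrite diag_mx_is_trig.
  rewrite -diagE /char_poly.
  pose Q := map_mx polyC (spectralmx Ac).
  have QU : Q \in unitmx.
    rewrite unitmxE det_map_mx; apply: rmorph_unit.
    by rewrite -unitmxE.
  have -> : char_poly_mx Ac = invmx Q *m char_poly_mx (diag_mx d) *m Q.
    rewrite /char_poly_mx mulmxBr mulmxBl scalar_mxC.
    rewrite -[_ *m invmx Q *m Q]mulmxA mulVmx // mulmx1.
    by rewrite {1}spec !map_mxM map_invmx.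
  rewrite !det_mulmx mulrAC -det_mulmx mulVmx // det1 mul1r //.
have dE i : j (complex.Re (d 0 i)) = d 0 i.
  by apply: RRe_real; have /mxOverP := hermitian_spectral_diag_real herm.
pose s0 := [tuple complex.Re (d 0 i) | i < n].
have szs : size (sort >=%R s0) == n by rewrite size_sort size_tuple.
exists (Tuple szs); split; first by apply: sort_sorted => x y; exact: le_total.
rewrite (perm_big s0) /=; last by rewrite perm_sort.
apply: (map_poly_inj j); rewrite map_char_poly -/Ac chE rmorph_prod big_map.
rewrite enumT; apply: eq_bigr => i _.
by rewrite rmorphB /= map_polyX map_polyC /= [_%:C]dE.
Qed.

(* Main.v *)
Require Import Defs.
From mathcomp Require Import all_boot all_order all_fingroup all_algebra.
From mathcomp Require Import all_classical all_reals all_analysis.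
From mathcomp Require Import ring lra.

Set Implicit Arguments.
Unset Strict Implicit.
Unset Printing Implicit Defensive.

Import Order.TTheory GRing.Theory Num.Theory.
Import numFieldNormedType.Exports.

Local Open Scope classical_set_scope.
Local Open Scope ring_scope.

(** Write C_t = t A + (1 - t) B, X = A - B and g = f'.  The reason for the
    inequality is that d/dt f[C_t] is the Schur product g[C_t] o X, and that
    g[C_t] is positive semidefinite, so that Schur multiplication by it is
    controlled by its diagonal.

    On the side of f, convexity on ordered pairs A >= B >= 0 is tested on
    matrices with only two distinct entries.  It says that the convexity defect
    of f at a pair x, y is dominated by its defect at any pair of the same
    length whose left end is at least |y| ([Sconv_defect_le]).  This forces f to
    be differentiable ([Sconv_derivable]) and g to be convex on [0, alpha)
    ([Sconv_derive_convex]).  Differentiating the convexity inequality at both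
    ends of a segment gives (g[A] - g[B]) o (A - B) >= 0; along a rank-one
    increment the Schur factor x x^T can be divided out, hence g[A] >= g[B]
    ([Sconv_derive_mono]), and g[A] >= g[0] >= 0 since g(0) >= 0.

    On the side of matrices, let P be positive semidefinite and X symmetric with
    singular values s_k.  The sum of the first m singular values of P o X is at
    most the sum over k <= m of s_k p_k, where p is any sequence whose partial
    sums dominate those of the ordered diagonal of P
    ([schur_singular_le]).  For P = g[C_t] one may take
    p_k = g(t lambda_k(A) + (1 - t) lambda_k(B)): the diagonal of C_t is
    dominated by the combination of eigenvalues by Schur's theorem
    ([eigvals_dominate_diag]), and a nondecreasing convex function preserves
    this domination ([topsum_dominates_convex]).

    Finally, the sum of the first m singular values of f[A] - f[B] is the
    trace of its product with a fixed symmetric matrix W, so it equals the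
    increment of t |-> tr (W f[C_t]) between 0 and 1.  Its derivative is bounded
    by the sum over k <= m of s_k(X) g(t lambda_k(A) + (1 - t) lambda_k(B)), and
    the increment of a primitive of that bound is the sum of the
    s_k(X) f^[1](lambda_k(A), lambda_k(B)); the mean value theorem compares the
    two increments ([ky_fan_entrywise]). *)

(** * Weighted sums and partial sums *)

(** The induction carries the stronger bound that the partial sum of the s i * z i
    is at least s k times the partial sum of the z i. *)
Lemma abel_sum_ge0 (R : realType) (n : nat) (s z : nat -> R) :
  (forall i j, (i <= j < n)%N -> s j <= s i) ->
  (forall i, (i < n)%N -> 0 <= s i) ->
  (forall k, (k <= n)%N -> 0 <= \sum_(i < k) z i) ->
  0 <= \sum_(i < n) s i * z i.
Proof.
move=> sdec s0 zpos.
suff main k : (k < n)%N ->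
    s k * (\sum_(i < k.+1) z i) <= \sum_(i < k.+1) s i * z i.
  case: n sdec s0 zpos main => [|n] sdec s0 zpos main; first by rewrite big_ord0.
  by apply: le_trans (main n _) => //; rewrite mulr_ge0 ?s0 ?zpos.
elim: k => [|k IH] kn; first by rewrite !big_ord1.
rewrite big_ord_recr [X in _ <= X]big_ord_recr /= mulrDr lerD2r.
apply: le_trans (IH (ltnW kn)); apply: ler_wpM2r; first exact/zpos/ltnW.
by apply: sdec; rewrite leqnSn.
Qed.

Lemma abel_sum_le (R : realType) (n : nat) (s x y : nat -> R) :
  (forall i j, (i <= j < n)%N -> s j <= s i) ->
  (forall i, (i < n)%N -> 0 <= s i) ->
  (forall k, (k <= n)%N -> \sum_(i < k) x i <= \sum_(i < k) y i) ->
  \sum_(i < n) s i * x i <= \sum_(i < n) s i * y i.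
Proof.
move=> sdec s0 xy; rewrite -subr_ge0 -sumrB.
under eq_bigr do rewrite -mulrBr.
apply: (abel_sum_ge0 (z := fun i => y i - x i)) => // k kn.
by rewrite sumrB subr_ge0 xy.
Qed.

Lemma sum_ord_lt (R : realType) (n k : nat) (F : nat -> R) : (k <= n)%N ->
  \sum_(i < k) F i = \sum_(i < n) (if (i < k)%N then F i else 0).
Proof.
move=> kn; rewrite (big_ord_widen _ F kn) big_mkcond.
by apply: eq_bigr.
Qed.

(** Both sides give the weights the same total mass, so s may be shifted by a
    constant c; with c = s (k - 1) the shifted terms are nonnegative below k and
    nonpositive above, and every term of the difference has the right sign. *)
Lemma weighted_sum_le_top (R : realType) (n k : nat) (s theta : nat -> R) :
  (k <= n)%N ->
  (forall i j, (i <= j < n)%N -> s j <= s i) ->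
  (forall i, (i < n)%N -> 0 <= theta i <= 1) ->
  \sum_(i < n) theta i = k%:R ->
  \sum_(i < n) theta i * s i <= \sum_(i < k) s i.
Proof.
move=> kn sdec th01 thk.
pose chi i : R := (i < k)%N%:R.
have chik : \sum_(i < n) chi i = k%:R.
  have <- : \sum_(i < k) (1 : R) = k%:R by rewrite sumr_const card_ord.
  rewrite (sum_ord_lt (fun=> 1) kn).
  by apply: eq_bigr => i _; rewrite /chi; case: ifP.
(* For k = 0 this is s 0, which still bounds all the entries. *)
pose c := s k.-1.
rewrite (sum_ord_lt s kn) -subr_ge0 -sumrB.
have -> : \sum_(i < n) ((if (i < k)%N then s i else 0) - theta i * s i) =
    \sum_(i < n) (chi i - theta i) * (s i - c).
  transitivity (\sum_(i < n) ((chi i - theta i) * s i - (chi i - theta i) * c)).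
    rewrite [RHS]sumrB -mulr_suml [X in _ - X * c]sumrB chik thk subrr mul0r subr0.
    by apply: eq_bigr => i _; rewrite mulrBl /chi; case: ifP; rewrite ?mul1r ?mul0r.
  by apply: eq_bigr => i _; rewrite mulrBr.
apply: sumr_ge0 => i _; have /andP[th0 th1] := th01 i (ltn_ord i).
rewrite /chi; case: ltnP => ik.
  rewrite mulr_ge0 ?subr_ge0 //; apply: sdec.
  by rewrite -ltnS (ltn_predK ik) ik /= (leq_trans _ kn) // (ltn_predK ik).
rewrite sub0r mulr_le0 ?oppr_le0 ?subr_le0 //.
by apply: sdec; rewrite (leq_trans (leq_pred k)) /=.
Qed.

(** The partial sums of b dominate the sums of the largest entries of c.  Testing
    with fractional weights theta instead of index sets avoids sorting c in
    statements, and is the form in which diagonals and eigenvalues are compared. *)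
Definition topsum_dominates (R : realType) (n : nat) (b : nat -> R)
    (c : 'I_n -> R) : Prop :=
  forall (j : nat) (theta : 'I_n -> R), (j <= n)%N ->
  (forall a, 0 <= theta a <= 1) -> \sum_a theta a = j%:R ->
  \sum_a theta a * c a <= \sum_(i < j) b i.

(** Karamata's inequality for weak majorization.  The subgradient inequality
    bounds each g (gam i) - g (c i) below by h (c i) * (gam i - c i), and the
    coefficients h (c i) are nonnegative and nonincreasing in i, so Abel
    summation applies. *)
Lemma karamata_weak (R : realType) (n : nat) (g h : R -> R) (D : set R)
    (c gam : nat -> R) :
  (forall x y, D x -> D y -> g x + h x * (y - x) <= g y) ->
  (forall x, D x -> 0 <= h x) ->
  (forall x y, D x -> D y -> x <= y -> h x <= h y) ->
  (forall i, (i < n)%N -> D (c i)) -> (forall i, (i < n)%N -> D (gam i)) ->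
  (forall i j, (i <= j < n)%N -> c j <= c i) ->
  (forall k, (k <= n)%N -> \sum_(i < k) c i <= \sum_(i < k) gam i) ->
  \sum_(i < n) g (c i) <= \sum_(i < n) g (gam i).
Proof.
move=> sub h0 hmon Dc Dg cdec maj.
rewrite -subr_ge0 -sumrB.
apply: (@le_trans _ _ (\sum_(i < n) h (c i) * (gam i - c i))); last first.
  by apply: ler_sum => i _; have := sub _ _ (Dc i (ltn_ord i)) (Dg i (ltn_ord i)); lra.
apply: (abel_sum_ge0 (s := h \o c) (z := fun i => gam i - c i)) => /=.
- move=> i j /andP[ij jn]; have ni := leq_ltn_trans ij jn.
  by apply: hmon; [exact: Dc|exact: Dc|apply: cdec; rewrite ij].
- by move=> i ni; apply/h0/Dc.
- by move=> k kn; rewrite sumrB subr_ge0 maj.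
Qed.

(** * Quadratic forms in coordinates *)

Lemma quadE (R : realType) (n : nat) (A : 'M[R]_n) (x : 'cV[R]_n) :
  (x^T *m A *m x) 0 0 = \sum_a \sum_b x a 0 * x b 0 * A a b.
Proof.
rewrite -mulmxA mxE; apply: eq_bigr => a _.
rewrite !mxE mulr_sumr; apply: eq_bigr => b _.
by rewrite mulrAC mulrA.
Qed.

Lemma psdmxP (R : realType) (n : nat) (A : 'M[R]_n) :
  psdmx A <-> symmx A /\
    forall x : 'I_n -> R, 0 <= \sum_a \sum_b x a * x b * A a b.
Proof.
split=> -[sA pA]; split=> // x; last by rewrite quadE.
have := pA (\col_a x a); rewrite quadE.
by under eq_bigr => a _ do under eq_bigr => b _ do rewrite !mxE.
Qed.

Lemma symmxE (R : realType) (n : nat) (A : 'M[R]_n) : symmx A ->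
  forall a b, A a b = A b a.
Proof. by move=> sA a b; rewrite -[in LHS]sA mxE. Qed.

Lemma sum_delta (R : realType) (n : nat) (F : 'I_n -> R) (a : 'I_n) :
  \sum_b (b == a)%:R * F b = F a.
Proof.
rewrite (bigD1 a) //= eqxx mul1r big1 ?addr0 // => b /negbTE ->.
by rewrite mul0r.
Qed.

Lemma quad2 (R : realType) (n : nat) (A : 'M[R]_n) (a b : 'I_n) (u v : R) :
  let x c := u * (c == a)%:R + v * (c == b)%:R in
  \sum_c \sum_d x c * x d * A c d =
  u ^+ 2 * A a a + u * v * A a b + v * u * A b a + v ^+ 2 * A b b.
Proof.
move=> x.
have inner c : \sum_d x c * x d * A c d = x c * (u * A c a + v * A c b).
  under eq_bigr do rewrite -mulrA.
  rewrite -mulr_sumr; congr (_ * _).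
  under eq_bigr do rewrite mulrDl -!mulrA.
  by rewrite big_split /= -!mulr_sumr !sum_delta.
under eq_bigr do rewrite inner mulrDl -!mulrA.
rewrite big_split /= -!mulr_sumr.
rewrite (sum_delta (fun c => u * A c a + v * A c b)).
rewrite (sum_delta (fun c => u * A c a + v * A c b)); ring.
Qed.

Lemma psd_diag_ge0 (R : realType) (n : nat) (A : 'M[R]_n) (a : 'I_n) :
  psdmx A -> 0 <= A a a.
Proof.
move=> /psdmxP[_ pA].
have := pA (fun c => 1 * (c == a)%:R + 0 * (c == a)%:R).
by rewrite quad2; lra.
Qed.

Lemma psd_offdiag_le (R : realType) (n : nat) (A : 'M[R]_n) (a b : 'I_n) :
  psdmx A -> `|A a b| <= (A a a + A b b) / 2.
Proof.
move=> /psdmxP[sA pA]; have Aba := symmxE sA b a.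
have := pA (fun c => 1 * (c == a)%:R + 1 * (c == b)%:R).
have := pA (fun c => 1 * (c == a)%:R + (- 1) * (c == b)%:R).
by rewrite !quad2 Aba ler_norml; lra.
Qed.

(** * The real spectral theorem *)

(** The reflection exchanging v and the first basis vector e, namely the one along
    w = v - e; it is undefined exactly when v = e, where the identity serves. *)
Lemma householder (R : realType) (n : nat) (v : 'rV[R]_n.+1) :
  v *m v^T = 1%:M ->
  exists2 H : 'M[R]_n.+1, H *m H^T = 1%:M & row 0 H = v.
Proof.
move=> v1; pose e : 'rV[R]_n.+1 := delta_mx 0 0.
have [ve|ve] := eqVneq v e.
  by exists 1%:M; rewrite ?trmx1 ?mulmx1 // row1 ve.
pose w := v - e; pose N := (w *m w^T) 0 0.
have ee : e *m e^T = 1%:M.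
  by rewrite trmx_delta mul_delta_mx; apply/matrixP => i j; rewrite !ord1 !mxE.
have wwN : w *m w^T = N%:M by rewrite [LHS]mx11_scalar.
have evT : e *m v^T = (v 0 0)%:M.
  rewrite [LHS]mx11_scalar; congr (_%:M).
  by rewrite /e -rowE !mxE.
have veT : v *m e^T = (v 0 0)%:M.
  by rewrite -[X in X *m _]trmxK -trmx_mul evT tr_scalar_mx.
have NE : N = 2 - 2 * v 0 0.
  rewrite /N /w linearB /= mulmxBl !mulmxBr v1 ee evT veT !mxE /=; ring.
have ewT : e *m w^T = (v 0 0 - 1)%:M.
  rewrite /w linearB /= mulmxBr evT ee.
  by apply/matrixP => i j; rewrite !ord1 !mxE.
have N0 : N != 0.
  apply: contraNneq ve => N0; apply/eqP/matrixP => i j; rewrite ord1.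
  move: N0; rewrite /N mxE => /psumr_eq0P s0.
  have /eqP : w 0 j * w^T j 0 = 0.
    by apply: s0 => // k _; rewrite [w^T _ _]mxE -expr2 sqr_ge0.
  by rewrite [w^T _ _]mxE mulf_eq0 orbb mxE [(- e) _ _]mxE subr_eq0 => /eqP.
pose H := 1%:M - (2 / N) *: (w^T *m w).
have HT : H^T = H by rewrite /H linearB /= linearZ /= trmx1 trmx_mul trmxK.
exists H; last first.
  rewrite rowE -/e /H mulmxBr mulmx1 -scalemxAr mulmxA ewT mul_scalar_mx scalerA.
  have -> : 2 / N * (v 0 0 - 1) = -1.
    by move: N0; rewrite NE => N0; field.
  by rewrite scaleN1r opprK /w addrC subrK.
have : (w^T *m w) *m (w^T *m w) = N *: (w^T *m w).
  by rewrite -mulmxA [w *m _]mulmxA wwN mul_scalar_mx -scalemxAr.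
rewrite HT /H; move: (w^T *m w) => P PP.
rewrite mulmxBl mul1mx mulmxBr mulmx1 -scalemxAl -scalemxAr PP !scalerA.
apply/matrixP => i j; rewrite !mxE; field.
exact: N0.
Qed.

(** Since the characteristic polynomial splits, A has a real unit eigenvector v; in
    an orthonormal basis starting with v the matrix becomes block diagonal, and
    the lower block is smaller. *)
Lemma symm_spectral (R : realType) (n : nat) (A : 'M[R]_n) : symmx A ->
  exists (d : 'rV[R]_n) (U : 'M[R]_n),
    U *m U^T = 1%:M /\ A = U^T *m diag_mx d *m U.
Proof.
elim: n A => [|n IH] A sA.
  by exists 0, 1%:M; split; apply/matrixP => -[].
have [_ chA] := eigvals_symP sA.
pose a := tnth (eigvals A) 0.
have : eigenvalue A a.
  rewrite eigenvalue_root_char chA root_prod_XsubC; exact: mem_tnth.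
move=> /eigenvalueP[v0 v0A v00].
pose N := (v0 *m v0^T) 0 0.
have N0 : 0 < N.
  rewrite lt_neqAle /N mxE sumr_ge0 ?andbT; last first.
    by move=> k _; rewrite mxE -expr2 sqr_ge0.
  apply: contraNneq v00 => /esym/psumr_eq0P s0; apply/eqP/matrixP => i j.
  rewrite ord1 [RHS]mxE; have /eqP : v0 0 j * v0^T j 0 = 0.
    by apply: s0 => // k _; rewrite [v0^T _ _]mxE -expr2 sqr_ge0.
  by rewrite [v0^T _ _]mxE mulf_eq0 orbb => /eqP.
pose v := (Num.sqrt N)^-1 *: v0.
have vA : v *m A = a *: v by rewrite -scalemxAl v0A !scalerA mulrC.
have v1 : v *m v^T = 1%:M.
  rewrite /v linearZ /= -scalemxAl -scalemxAr scalerA -invfM -expr2.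
  rewrite sqr_sqrtr ?ltW // [v0 *m _]mx11_scalar -/N scale_scalar_mx mulVf //.
  by rewrite gt_eqF.
have [H HH Hv] := householder v1.
have HH' : H^T *m H = 1%:M by exact: mulmx1C.
pose M : 'M[R]_(1 + n) := H *m A *m H^T.
have sM : M^T = M by rewrite /M !trmx_mul trmxK sA mulmxA.
have rM : row 0 M = a *: delta_mx 0 0.
  rewrite /M !row_mul Hv vA -scalemxAl; congr (_ *: _).
  by rewrite -Hv -row_mul HH row1.
have M0 j : M (lshift n 0) j = a * (j == lshift n 0)%:R.
  have -> : lshift n 0 = 0 :> 'I_(1 + n) by exact: val_inj.
  by have := congr1 (fun X : 'rV_(1+n) => X 0 j) rM; rewrite !mxE eqxx.
have AM : A = H^T *m M *m H.
  by rewrite /M !mulmxA HH' mul1mx -mulmxA HH' mulmx1.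
clearbody M; pose B := drsubmx M.
have sB : symmx B by rewrite /symmx /B trmx_drsub sM.
have ME : M = block_mx a%:M 0 0 B.
  rewrite -[LHS]submxK; congr block_mx; apply/matrixP => i j; rewrite !mxE.
  - by rewrite !ord1 M0 eqxx mulr1.
  - by rewrite !ord1 M0 eq_rlshift mulr0.
  - by rewrite -sM mxE !ord1 M0 eq_rlshift mulr0.
have [d [Q [QQ BE]]] := IH B sB.
pose Q1 : 'M[R]_(1 + n) := block_mx 1%:M 0 0 Q.
have Q1T : Q1^T = block_mx 1%:M 0 0 Q^T.
  by rewrite /Q1 tr_block_mx !trmx0 trmx1.
have Q1Q1 : Q1 *m Q1^T = 1%:M.
  rewrite Q1T /Q1 mulmx_block !mul0mx !mulmx0 !addr0 !add0r mulmx1 QQ.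
  by rewrite -scalar_mx_block.
have MQ : M = Q1^T *m diag_mx (row_mx a%:M d) *m Q1.
  rewrite ME Q1T /Q1 diag_mx_row !mulmx_block.
  rewrite !mul0mx !mulmx0 !addr0 !add0r !mul0mx !mulmx1 !mul1mx -BE.
  by congr block_mx; apply/matrixP => i j; rewrite !ord1 !mxE.
exists (row_mx a%:M d : 'rV_(1 + n)), (Q1 *m H); split.
  by rewrite trmx_mul mulmxA -[_ *m _ *m H^T]mulmxA HH mulmx1.
by rewrite AM MQ trmx_mul !mulmxA.
Qed.

(** * Eigenvalues and singular values in coordinates *)

Definition orthomx (R : realType) (n : nat) (U : 'M[R]_n) := U *m U^T = 1%:M.

Lemma orthomx_row (R : realType) (n : nat) (U : 'M[R]_n) : orthomx U ->
  forall k l, \sum_a U k a * U l a = (k == l)%:R.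
Proof.
move=> UU k l; have := congr1 (fun X : 'M[R]_n => X k l) UU; rewrite !mxE => <-.
by apply: eq_bigr => a _; rewrite mxE.
Qed.

Lemma orthomx_col (R : realType) (n : nat) (U : 'M[R]_n) : orthomx U ->
  forall a b, \sum_k U k a * U k b = (a == b)%:R.
Proof.
move=> /mulmx1C UU a b; have := congr1 (fun X : 'M[R]_n => X a b) UU.
rewrite !mxE => <-; by apply: eq_bigr => k _; rewrite mxE.
Qed.

Lemma row_perm_orthomx (R : realType) (n : nat) (p : {perm 'I_n}) (U : 'M[R]_n) :
  orthomx U -> orthomx (row_perm p U).
Proof.
move=> UU; apply/matrixP => k l; rewrite !mxE.
under eq_bigr do rewrite !mxE.
by rewrite (orthomx_row UU) (inj_eq perm_inj).
Qed.

Lemma spectralE (R : realType) (n : nat) (d : 'rV[R]_n) (U : 'M[R]_n) a b :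
  (U^T *m diag_mx d *m U) a b = \sum_k d 0 k * U k a * U k b.
Proof.
rewrite mul_mx_diag mxE; apply: eq_bigr => k _.
by rewrite !mxE; congr (_ * _); rewrite mulrC.
Qed.

Lemma char_poly_ortho (R : realType) (n : nat) (d : 'rV[R]_n) (U : 'M[R]_n) :
  orthomx U ->
  char_poly (U^T *m diag_mx d *m U) = \prod_i ('X - (d 0 i)%:P).
Proof.
move=> UU.
have diagE : char_poly (diag_mx d) = \prod_i ('X - (d 0 i)%:P).
  rewrite char_poly_trig; last by rewrite diag_mx_is_trig.
  by apply: eq_bigr => i _; rewrite mxE eqxx.
rewrite -diagE /char_poly.
pose Q := map_mx polyC U.
have QQ : Q^T *m Q = 1%:M.
  by rewrite /Q map_trmx -map_mxM (mulmx1C UU) map_mx1.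
have -> : char_poly_mx (U^T *m diag_mx d *m U) =
    Q^T *m char_poly_mx (diag_mx d) *m Q.
  rewrite /char_poly_mx mulmxBr mulmxBl scalar_mxC.
  rewrite -[_ *m Q^T *m Q]mulmxA QQ mulmx1.
  by rewrite !map_mxM /Q map_trmx.
by rewrite !det_mulmx mulrAC -det_mulmx QQ det1 mul1r.
Qed.

Lemma eigvals_ortho (R : realType) (n : nat) (d : 'rV[R]_n) (U : 'M[R]_n) :
  orthomx U ->
  exists p : {perm 'I_n}, forall k,
    tnth (eigvals (U^T *m diag_mx d *m U)) k = d 0 (p k).
Proof.
move=> UU; set A := U^T *m _ *m U.
have sA : symmx A.
  by rewrite /symmx /A !trmx_mul trmxK tr_diag_mx mulmxA.
have [_ chA] := eigvals_symP sA.
have : perm_eq (eigvals A) [tuple d 0 i | i < n].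
  apply: prod_XsubC_eq; rewrite -chA char_poly_ortho //.
  by rewrite [RHS]big_tuple; apply: eq_bigr => i _; rewrite tnth_mktuple.
move=> /tuple_permP[p /val_inj Ep]; exists p => k.
by rewrite Ep !tnth_mktuple.
Qed.

(** Permuting the rows of the eigenvector matrix lists the eigenvalues in the
    decreasing order of [eigvals], which the comparison of partial sums needs. *)
Lemma spectral_eigvals (R : realType) (n : nat) (A : 'M[R]_n) : symmx A ->
  exists2 U : 'M[R]_n, orthomx U &
    forall a b, A a b = \sum_k tnth (eigvals A) k * U k a * U k b.
Proof.
move=> /symm_spectral[d [U [UU ->]]].
have [p Ep] := eigvals_ortho d UU.
exists (row_perm p U) => [|a b]; first exact: row_perm_orthomx.
rewrite [LHS]spectralE (reindex_inj (@perm_inj _ p)) /=.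
by apply: eq_bigr => k _; rewrite Ep !mxE.
Qed.

(** For a symmetric matrix the singular values are the absolute values of the
    eigenvalues, so a signed spectral decomposition ordered by absolute value
    replaces the singular value decomposition. *)
Lemma spectral_singvals (R : realType) (n : nat) (Z : 'M[R]_n) : symmx Z ->
  exists (U : 'M[R]_n) (mu : 'I_n -> R),
  [/\ orthomx U, forall a b, Z a b = \sum_k mu k * U k a * U k b &
    forall k, `|mu k| = tnth (singvals Z) k].
Proof.
move=> sZ; have [d [U [UU ZE]]] := symm_spectral sZ.
pose d2 : 'rV[R]_n := \row_i d 0 i ^+ 2.
have ZZ : Z^T *m Z = U^T *m diag_mx d2 *m U.
  rewrite sZ ZE !mulmxA -[_ *m U *m U^T]mulmxA UU mulmx1; congr (_ *m _).
  by rewrite -mulmxA mulmx_diag; congr (_ *m diag_mx _).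
have [p Ep] := eigvals_ortho d2 UU.
exists (row_perm p U), (fun k => d 0 (p k)); split.
- exact: row_perm_orthomx.
- move=> a b; rewrite ZE spectralE (reindex_inj (@perm_inj _ p)) /=.
  by apply: eq_bigr => k _; rewrite !mxE.
- by move=> k; rewrite tnth_mktuple ZZ Ep mxE sqrtr_sqr.
Qed.

Lemma ge_trans (R : realType) : transitive (>=%R : rel R).
Proof. by move=> y x z /[swap]; exact: le_trans. Qed.

Lemma sorted_nth_le (R : realType) (s : seq R) : sorted >=%R s ->
  forall i j, (i <= j < size s)%N -> s`_j <= s`_i.
Proof.
move=> ss i j /andP[ij js].
by apply: (sorted_leq_nth (@ge_trans R) (@lexx _ R) 0 ss) => //; exact: leq_ltn_trans js.
Qed.

Lemma eigvals_dec (R : realType) (n : nat) (A : 'M[R]_n) : symmx A ->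
  forall i j, (i <= j < n)%N -> (eigvals A)`_j <= (eigvals A)`_i.
Proof.
move=> /eigvals_symP[ss _] i j ij; apply: sorted_nth_le => //.
by rewrite size_tuple.
Qed.

Lemma singvals_sorted (R : realType) (n : nat) (X : 'M[R]_n) :
  sorted >=%R (singvals X).
Proof.
have sX : symmx (X^T *m X) by rewrite /symmx trmx_mul trmxK.
have [ss _] := eigvals_symP sX.
have -> : singvals X = map Num.sqrt (eigvals (X^T *m X)) :> seq R.
  by rewrite -[in RHS](map_tnth_enum (eigvals _)) -map_comp.
by apply: homo_sorted ss => x y; exact: ler_wsqrtr.
Qed.

(** The supremum in [opnorm] is bounded above because every image of the unit ball
    is bounded by the Euclidean norm of the vector of l1-norms of the rows. *)
Lemma opnorm_ubound (R : realType) (n : nat) (A : 'M[R]_n) (x : 'cV[R]_n) :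
  norm2 x <= 1 -> norm2 (A *m x) <= opnorm A.
Proof.
move=> x1; apply: ub_le_sup; last by exists x.
exists (Num.sqrt (\sum_i (\sum_j `|A i j|) ^+ 2)) => _ [y y1 <-].
rewrite /norm2 ler_wsqrtr //; apply: ler_sum => i _.
rewrite -real_normK ?num_real // lerXn2r ?nnegrE ?sumr_ge0 //.
rewrite mxE; apply: le_trans (ler_norm_sum _ _ _) _.
apply: ler_sum => j _; rewrite normrM ler_piMr //.
apply: le_trans y1; rewrite /norm2 -sqrtr_sqr ler_wsqrtr //.
by rewrite (bigD1 j) //= lerDl sumr_ge0 // => k _; rewrite sqr_ge0.
Qed.

Lemma eigvals_le_opnorm (R : realType) (n : nat) (A : 'M[R]_n) : symmx A ->
  forall k, tnth (eigvals A) k <= opnorm A.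
Proof.
move=> sA k; have [U UU AE] := spectral_eigvals sA.
pose x : 'cV[R]_n := \col_a U k a.
have x1 : norm2 x = 1.
  rewrite /norm2; under eq_bigr do rewrite mxE expr2.
  by rewrite (orthomx_row UU) eqxx sqrtr1.
have Ax : A *m x = tnth (eigvals A) k *: x.
  apply/matrixP => a j; rewrite ord1 !mxE.
  under eq_bigr do rewrite AE mxE mulr_suml.
  rewrite exchange_big /= -(sum_delta (fun l => tnth (eigvals A) l * U l a) k).
  apply: eq_bigr => l _; rewrite -(orthomx_row UU) mulr_suml.
  by apply: eq_bigr => j' _; ring.
apply: le_trans (ler_norm _) _.
suff -> : `|tnth (eigvals A) k| = norm2 (A *m x) by rewrite opnorm_ubound ?x1.
rewrite Ax /norm2; under eq_bigr do rewrite mxE exprMn.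
by rewrite -mulr_sumr sqrtrM ?sqr_ge0 // sqrtr_sqr -/(norm2 x) x1 mulr1.
Qed.

Lemma rayleigh_eigenvector (R : realType) (n : nat) (A U : 'M[R]_n)
    (d : 'I_n -> R) (k : 'I_n) : orthomx U ->
  (forall a b, A a b = \sum_l d l * U l a * U l b) ->
  \sum_a \sum_b U k a * U k b * A a b = d k.
Proof.
move=> UU AE.
under eq_bigr => a _ do under eq_bigr => b _ do rewrite AE mulr_sumr.
under eq_bigr => a _ do rewrite exchange_big.
rewrite exchange_big /= -[RHS](sum_delta d k); apply: eq_bigr => l _.
have -> : (l == k)%:R = (l == k)%:R * (l == k)%:R :> R.
  by case: eqP; rewrite ?mulr1 ?mulr0.
rewrite -(orthomx_row UU) mulrC mulr_suml mulr_sumr; apply: eq_bigr => a _.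
by rewrite !mulr_sumr; apply: eq_bigr => b _; ring.
Qed.

Lemma eigvals_ge0 (R : realType) (n : nat) (A : 'M[R]_n) : psdmx A ->
  forall k, 0 <= tnth (eigvals A) k.
Proof.
move=> /psdmxP[sA pA] k; have [U UU AE] := spectral_eigvals sA.
by rewrite -(rayleigh_eigenvector k UU AE); exact: (pA (U k)).
Qed.

(** * Schur products with a positive semidefinite matrix *)

Lemma ord_fun_extend (R : realType) (n : nat) (G : 'I_n -> R) :
  exists F : nat -> R, forall i : 'I_n, F i = G i.
Proof.
by exists (fun i => oapp G 0 (insub i)) => i; rewrite valK.
Qed.

Lemma sum_ord_cond (R : realType) (n k : nat) (F : nat -> R) : (k <= n)%N ->
  \sum_(i < k) F i = \sum_(i < n | (i < k)%N) F i.
Proof. exact: big_ord_widen. Qed.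

Lemma sum_indicator_ord (R : realType) (n k : nat) : (k <= n)%N ->
  \sum_(i < n | (i < k)%N) 1 = k%:R :> R.
Proof.
by move=> kn; rewrite -(sum_ord_cond (fun=> 1) kn) sumr_const card_ord.
Qed.

Lemma partial_frame_le (R : realType) (n : nat) (p : 'I_n -> R) (b : nat -> R)
    (W : 'M[R]_n) (j : nat) :
  topsum_dominates b p ->
  orthomx W -> (j <= n)%N ->
  \sum_(k < n | (k < j)%N) \sum_a W k a ^+ 2 * p a <= \sum_(i < j) b i.
Proof.
move=> p_top WW jn; rewrite exchange_big /=.
under eq_bigr do rewrite -mulr_suml.
apply: p_top => //.
- move=> a; rewrite sumr_ge0 => [|k _]; last exact: sqr_ge0.
  have <- : \sum_k W k a ^+ 2 = 1.
    by under eq_bigr do rewrite expr2; rewrite (orthomx_col WW) eqxx.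
  rewrite [X in _ <= X](bigID (fun k : 'I_n => (k < j)%N)) /= lerDl.
  by rewrite sumr_ge0 // => k _; rewrite sqr_ge0.
- rewrite exchange_big /= -(sum_indicator_ord R jn); apply: eq_bigr => k _.
  by under eq_bigr do rewrite expr2; rewrite (orthomx_row WW) eqxx.
Qed.

(** Summing over all rows of an orthogonal matrix replaces W i a * W i c by the
    Kronecker delta, which leaves only the diagonal of P. *)
Lemma frame_quad_sum (R : realType) (n : nat) (P W : 'M[R]_n) (x : 'I_n -> R) :
  orthomx W ->
  \sum_i \sum_a \sum_c (W i a * x a) * (W i c * x c) * P a c =
  \sum_a x a ^+ 2 * P a a.
Proof.
move=> WW; rewrite exchange_big; apply: eq_bigr => a _; rewrite exchange_big /=.
rewrite -[RHS](sum_delta (fun c => x a * x c * P a c) a).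
apply: eq_bigr => c _; rewrite eq_sym -(orthomx_col WW) mulr_suml.
by apply: eq_bigr => i _; ring.
Qed.

(** With Q i k the quadratic form of P at the entrywise product of V i and U k,
    the left-hand side is a sum of eps i * mu k * Q i k.  All Q i k are
    nonnegative, so signs may be dropped.  Summing Q i k over all i, or over all
    k, gives an average of the diagonal of P; hence the partial sums in k of the
    sums over i < m are at most both b 0 + ... + b (j - 1) and
    b 0 + ... + b (m - 1), and Abel summation against sigma finishes. *)
Lemma schur_singular_le (R : realType) (n m : nat) (P X U V : 'M[R]_n)
    (mu eps : 'I_n -> R) (sigma b : nat -> R) :
  (m <= n)%N -> psdmx P -> orthomx U -> orthomx V ->
  (forall a c, X a c = \sum_k mu k * U k a * U k c) ->
  (forall i, `|eps i| <= 1) -> (forall k, `|mu k| = sigma k) ->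
  (forall i j, (i <= j < n)%N -> sigma j <= sigma i) ->
  topsum_dominates b (fun a => P a a) ->
  \sum_(i < n | (i < m)%N)
      eps i * \sum_a \sum_c V i a * V i c * (P a c * X a c) <=
  \sum_(k < m) sigma k * b k.
Proof.
move=> mn psdP UU VV XE eps1 muE sdec p_top.
have /psdmxP[_ qP] := psdP.
pose Q i k := \sum_a \sum_c (V i a * U k a) * (V i c * U k c) * P a c.
have Q0 i k : 0 <= Q i k by apply: (qP (fun a => V i a * U k a)).
have VPX i : \sum_a \sum_c V i a * V i c * (P a c * X a c) =
    \sum_k mu k * Q i k.
  under eq_bigr => a _ do under eq_bigr => c _ do rewrite XE !mulr_sumr.
  under eq_bigr => a _ do rewrite exchange_big.
  rewrite exchange_big /=; apply: eq_bigr => k _.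
  rewrite mulr_sumr; apply: eq_bigr => a _.
  by rewrite mulr_sumr; apply: eq_bigr => c _; ring.
have sumQV k : \sum_i Q i k = \sum_a U k a ^+ 2 * P a a.
  exact: frame_quad_sum.
have sumQU i : \sum_k Q i k = \sum_a V i a ^+ 2 * P a a.
  rewrite -(frame_quad_sum P (V i) UU); apply: eq_bigr => k _.
  by apply: eq_bigr => a _; apply: eq_bigr => c _; ring.
have [q qE] := ord_fun_extend (fun k => \sum_(i < n | (i < m)%N) Q i k).
apply: (@le_trans _ _ (\sum_(k < n) sigma k * q k)).
  under [X in _ <= X]eq_bigr do rewrite qE mulr_sumr.
  rewrite [X in _ <= X]exchange_big /=; apply: ler_sum => i _.
  rewrite VPX mulr_sumr; apply: ler_sum => k _.
  rewrite mulrA ler_wpM2r // -muE; apply: le_trans (ler_norm _) _.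
  by rewrite normrM ler_piMl.
pose c k := if (k < m)%N then b k else 0.
have -> : \sum_(k < m) sigma k * b k = \sum_(k < n) sigma k * c k.
  rewrite (sum_ord_lt (fun k => sigma k * b k) mn); apply: eq_bigr => k _.
  by rewrite /c; case: ifP; rewrite ?mulr0.
apply: abel_sum_le => // [k kn|j jn]; first by rewrite -(muE (Ordinal kn)).
rewrite (sum_ord_cond _ jn); under eq_bigr do rewrite qE.
(* For j <= m the sum over i < m is enlarged to all i; for j > m the sum over
   k < j is enlarged to all k instead. *)
have [jm|mj] := leqP j m.
  have -> : \sum_(i < j) c i = \sum_(i < j) b i.
    by apply: eq_bigr => i _; rewrite /c (leq_trans (ltn_ord i) jm).
  apply: le_trans (partial_frame_le p_top UU jn); apply: ler_sum => k _.
  rewrite -sumQV [X in _ <= X](bigID (fun i : 'I_n => (i < m)%N)) /= lerDl.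
  by rewrite sumr_ge0.
have -> : \sum_(i < j) c i = \sum_(i < m) b i.
  by rewrite (sum_ord_lt b (ltnW mj)).
apply: le_trans (partial_frame_le p_top VV mn); rewrite exchange_big /=.
apply: ler_sum => i _.
rewrite -sumQU [X in _ <= X](bigID (fun k : 'I_n => (k < j)%N)) /= lerDl.
by rewrite sumr_ge0.
Qed.

(** * Two-level matrices *)

(** The class of i0 and its complement carry a constant block each, so that the
    2 x 2 matrix with rows (a, x) and (x, a) is reproduced in any size n >= 2
    with no entries other than a and x. *)
Definition twolevel (R : realType) (n : nat) (i0 : 'I_n) (a x : R) : 'M[R]_n :=
  \matrix_(i, j) if (i == i0) == (j == i0) then a else x.

(** The matrix is (a + x)/2 J + (a - x)/2 e e^T, where J has all entries 1 and e
    is the sign vector of the two classes. *)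
Lemma psd_twolevel (R : realType) (n : nat) (i0 : 'I_n) (a x : R) :
  `|x| <= a -> psdmx (twolevel i0 a x).
Proof.
rewrite ler_norml => /andP[xa ax]; apply/psdmxP; split.
  by apply/matrixP => i j; rewrite !mxE eq_sym.
move=> v; pose e i : R := if i == i0 then 1 else -1.
suff -> : \sum_i \sum_j v i * v j * twolevel i0 a x i j =
    (a + x) / 2 * (\sum_i v i) ^+ 2 + (a - x) / 2 * (\sum_i e i * v i) ^+ 2.
  by rewrite addr_ge0 // mulr_ge0 ?sqr_ge0 //; lra.
rewrite !expr2 !mulr_suml !mulr_sumr -big_split; apply: eq_bigr => i _ /=.
rewrite !mulr_sumr -big_split; apply: eq_bigr => j _ /=.
by rewrite mxE /e; case: (i == i0); case: (j == i0) => /=; field.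
Qed.

Lemma psd_twolevel_le (R : realType) (n : nat) (i0 i1 : 'I_n) (a x : R) :
  i1 != i0 -> psdmx (twolevel i0 a x) -> `|x| <= a.
Proof.
move=> i10 /(psd_offdiag_le i0 i1); rewrite !mxE !eqxx /= (negbTE i10) /=; lra.
Qed.

Lemma exists_other_ord (n : nat) : (2 <= n)%N ->
  exists i0 i1 : 'I_n, i1 != i0.
Proof.
by case: n => [|[|n]] // _; exists ord0, (lift ord0 ord0).
Qed.

(** * Differentiability of entrywise convex functions *)

Definition convdefect (R : realType) (f : R -> R) (x y t : R) : R :=
  t * f x + (1 - t) * f y - f (t * x + (1 - t) * y).

(** Convexity on [0, beta) as monotonicity of the slopes of adjacent chords,
    cleared of denominators. *)
Definition convex_below (R : realType) (beta : R) (f : R -> R) : Prop :=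
  forall x y w, 0 <= x -> x < y -> y < w -> w < beta ->
  (f y - f x) * (w - y) <= (f w - f y) * (y - x).

Lemma in_itv_finP (R : realType) (beta x : R) :
  Defs.in_itv beta%:E x <-> `|x| < beta.
Proof. by rewrite /Defs.in_itv -EFinN !lte_fin ltr_norml. Qed.

Lemma Sconv_restrict (R : realType) (n : nat) (alpha : \bar R) (beta : R)
    (f : R -> R) : (beta%:E <= alpha)%E -> Sconv n alpha f -> Sconv n beta%:E f.
Proof.
move=> ba hf A B sA sB iA iB; apply: hf => // i j.
  have /andP[h1 h2] := iA i j; apply/andP; split; last exact: lt_le_trans ba.
  by apply: le_lt_trans h1; rewrite leeN2.
have /andP[h1 h2] := iB i j; apply/andP; split; last exact: lt_le_trans ba.
by apply: le_lt_trans h1; rewrite leeN2.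
Qed.

(** Apply the convexity hypothesis to the two-level matrices with rows
    (b + |x - y|, x) and (b, y); their difference has all entries of absolute
    value |x - y|, hence is positive semidefinite. *)
Lemma Sconv_defect_le (R : realType) (n : nat) (beta : R) (f : R -> R)
    (x y b t : R) :
  (2 <= n)%N -> Sconv n beta%:E f -> 0 <= t <= 1 -> `|y| <= b ->
  b + `|x - y| < beta ->
  `|convdefect f x y t| <= convdefect f (b + `|x - y|) b t.
Proof.
move=> n2 hf t01 yb bxy.
have [i0 [i1 i10]] := exists_other_ord n2.
set a := b + `|x - y|.
have xa : `|x| <= a.
  by rewrite -[x in `|x|](subrK y) addrC (le_trans (ler_normD _ _)) // lerD2r.
have ba : b <= a by rewrite lerDl.
have b0 : 0 <= b by exact: le_trans yb.
pose A := twolevel i0 a x; pose B := twolevel i0 b y.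
have AB : A - B = twolevel i0 `|x - y| (x - y).
  by apply/matrixP => i j; rewrite !mxE; case: ifP => // _; rewrite /a addrAC subrr add0r.
have := hf A B _ _ _ _ _ _ t t01.
rewrite /loewner_le AB subr0.
have -> : t *: map_mx f A + (1 - t) *: map_mx f B -
    map_mx f (t *: A + (1 - t) *: B) =
    twolevel i0 (convdefect f a b t) (convdefect f x y t).
  by apply/matrixP => i j; rewrite !mxE /convdefect; case: ifP.
move=> H; apply: (psd_twolevel_le i10); apply: H.
- by case: (psd_twolevel i0 xa).
- by case: (psd_twolevel i0 yb).
- move=> i j; apply/in_itv_finP; rewrite mxE; case: ifP => _.
    by rewrite ger0_norm // (le_trans b0).
  exact: le_lt_trans xa bxy.
- move=> i j; apply/in_itv_finP; rewrite mxE; case: ifP => _.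
    by rewrite ger0_norm // (le_lt_trans ba).
  by apply: le_lt_trans yb _; exact: le_lt_trans ba _.
- exact: psd_twolevel.
- exact: psd_twolevel.
Qed.

Lemma convex_below_of_defect (R : realType) (beta : R) (f : R -> R) :
  (forall x w t, 0 <= x -> x < w -> w < beta -> 0 <= t <= 1 ->
    0 <= convdefect f w x t) -> convex_below beta f.
Proof.
move=> defect_ge0 x y w x0 xy yw wb.
have wx : 0 < w - x by lra.
pose t := (y - x) / (w - x).
have tE : t * (w - x) = y - x by rewrite /t mulfVK // gt_eqF.
have t01 : 0 <= t <= 1.
  by rewrite /t divr_ge0 ?ler_pdivrMr ?mul1r //; lra.
have := defect_ge0 x w t x0 (lt_trans xy yw) wb t01.
rewrite /convdefect (_ : t * w + (1 - t) * x = y); last first.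
  by rewrite mulrBl mul1r addrCA -mulrBr tE addrC subrK.
move=> d0; rewrite -subr_ge0.
have -> : (f w - f y) * (y - x) - (f y - f x) * (w - y) =
  (w - x) * (t * f w + (1 - t) * f x - f y).
  rewrite !mulrDr mulrN mulrA [(w - x) * t]mulrC tE.
  rewrite [(w - x) * _]mulrA [(w - x) * (1 - t)]mulrBr mulr1 [(w - x) * t]mulrC tE.
  ring.
by rewrite mulr_ge0 // ltW.
Qed.

Lemma Sconv_convex (R : realType) (n : nat) (beta : R) (f : R -> R) :
  (2 <= n)%N -> Sconv n beta%:E f -> convex_below beta f.
Proof.
move=> n2 hf; apply: convex_below_of_defect => x w t x0 xw wb t01.
have wxE : `|w - x| = w - x by rewrite ger0_norm // subr_ge0 ltW.
have := @Sconv_defect_le _ n beta f w x x t n2 hf t01.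
rewrite wxE ger0_norm // addrC subrK => /(_ (lexx x) wb).
exact: (le_trans (normr_ge0 _)).
Qed.

Lemma convex_slope_le (R : realType) (beta : R) (f : R -> R) (x y u w : R) :
  convex_below beta f -> 0 <= x -> x < y -> y <= u -> u < w -> w < beta ->
  (f y - f x) / (y - x) <= (f w - f u) / (w - u).
Proof.
move=> cf x0 xy yu uw wb.
have adj p q r : 0 <= p -> p < q -> q < r -> r < beta ->
    (f q - f p) / (q - p) <= (f r - f q) / (r - q).
  move=> p0 pq qr rb; rewrite ler_pdivrMr ?subr_gt0 // mulrAC.
  by rewrite ler_pdivlMr ?subr_gt0 // cf.
have [yuE|ney] := eqVneq y u; first by rewrite -yuE in uw *; exact: adj.
have {}yu : y < u by rewrite lt_neqAle ney.
apply: (@le_trans _ _ ((f u - f y) / (u - y))); apply: adj => //; lra.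
Qed.

(** f has no kink.  By [Sconv_defect_le] the second difference at z is at most the
    one at w for every w further to the right.  Summing over N + 1 consecutive
    points w telescopes to a difference of two increments of the convex
    function f, each comparable to h; so the second difference at z is
    O(h / N). *)
Lemma Sconv_defect_bound (R : realType) (n : nat) (beta z : R) (f : R -> R) :
  (2 <= n)%N -> Sconv n beta%:E f -> `|z| < beta ->
  forall e, 0 < e -> exists2 h0, 0 < h0 &
    forall h, 0 < h <= h0 -> `|f (z + h) + f (z - h) - 2 * f z| <= h * e.
Proof.
move=> n2 hf zb e e0.
have cf := Sconv_convex n2 hf.
pose r := (beta - `|z|) / 8.
have r0 : 0 < r by rewrite /r; lra.
have rE : beta = `|z| + 8 * r by rewrite /r; lra.
have zn := normr_ge0 z.
pose w0 := `|z| + 2 * r.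
pose S1 := (f r - f 0) / (r - 0).
pose S2 := (f (w0 + 3 * r) - f (w0 + 2 * r)) / (w0 + 3 * r - (w0 + 2 * r)).
have [N NS] : exists N : nat, (S2 - S1) / e < N%:R.
  by exists (Num.truncn ((S2 - S1) / e)).+1; exact: truncnS_gt.
exists (r / N.+1%:R) => [|h /andP[h0 hr]]; first by rewrite divr_gt0.
have Nh : N.+1%:R * h <= r by rewrite mulrC -ler_pdivlMr.
have hler : h <= r.
  by apply: le_trans Nh; rewrite ler_peMl ?ler1n // ltW.
(* The points w j - h have to lie to the right of |z - h|. *)
pose w (j : nat) := w0 + j%:R * h.
have wS j : w j.+1 = w j + h by rewrite /w -addn1 natrD mulrDl mul1r addrA.
have step j : (j <= N)%N ->
    `|f (z + h) + f (z - h) - 2 * f z| <= f (w j + h) - f (w j) - (f (w j) - f (w j - h)).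
  move=> jN.
  have jh : 0 <= j%:R * h <= r.
    rewrite mulr_ge0 ?(ltW h0) //=; apply: le_trans Nh.
    by rewrite ler_wpM2r ?(ltW h0) // ler_nat (leq_trans jN).
  have t01 : 0 <= (2^-1 : R) <= 1 by lra.
  have xyE : `|z + h - (z - h)| = 2 * h.
    by rewrite (_ : z + h - (z - h) = 2 * h) ?ger0_norm //; lra.
  have := @Sconv_defect_le _ n beta f (z + h) (z - h) (w j - h) 2^-1 n2 hf t01.
  rewrite xyE => /(_ _ _)/le_trans.
  have -> : w j - h + 2 * h = w j + h by ring.
  rewrite /convdefect.
  have -> : 2^-1 * (z + h) + (1 - 2^-1) * (z - h) = z by field.
  have -> : 2^-1 * (w j + h) + (1 - 2^-1) * (w j - h) = w j by field.
  have -> : 2^-1 * f (z + h) + (1 - 2^-1) * f (z - h) - f z =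
    2^-1 * (f (z + h) + f (z - h) - 2 * f z) by field.
  rewrite normrM (ger0_norm (_ : 0 <= 2^-1)) ?invr_ge0 // => H.
  rewrite -(ler_pM2l (_ : 0 < 2^-1)) ?invr_gt0 //; apply: H => //.
  - apply: le_trans (ler_normB _ _) _; rewrite (ger0_norm (ltW h0)) /w /w0; lra.
  - by rewrite /w /w0 rE; lra.
  - lra.
have : \sum_(j < N.+1) `|f (z + h) + f (z - h) - 2 * f z| <=
    \sum_(j < N.+1) (f (w j + h) - f (w j) - (f (w j) - f (w j - h))).
  by apply: ler_sum => j _; apply: step; rewrite -ltnS.
have -> : \sum_(j < N.+1) (f (w j + h) - f (w j) - (f (w j) - f (w j - h))) =
    (f (w N + h) - f (w N)) - (f (w0) - f (w0 - h)).
  elim: N {NS hr Nh step} => [|N IH].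
    by rewrite big_ord1 /w mul0r addr0.
  rewrite big_ord_recr IH /= wS addrK; ring.
rewrite sumr_const card_ord -[_ *+ N.+1]mulr_natl => bound.
have top : f (w N + h) - f (w N) <= h * S2.
  have : (f (w N + h) - f (w N)) / (w N + h - w N) <= S2.
    have Nh' : N%:R * h + h <= r by move: Nh; rewrite -addn1 natrD mulrDl mul1r.
    have Nh0 : 0 <= N%:R * h by rewrite mulr_ge0 // ltW.
    by apply: (convex_slope_le cf); rewrite /w /w0 ?rE; lra.
  by rewrite (_ : w N + h - w N = h) ?ler_pdivrMr 1?[S2 * h]mulrC //; ring.
have bot : h * S1 <= f w0 - f (w0 - h).
  have : S1 <= (f w0 - f (w0 - h)) / (w0 - (w0 - h)).
    by apply: (convex_slope_le cf); rewrite /w0 ?rE; lra.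
  by rewrite (_ : w0 - (w0 - h) = h) ?ler_pdivlMr 1?[S1 * h]mulrC //; ring.
have bound2 : N.+1%:R * `|f (z + h) + f (z - h) - 2 * f z| <= N.+1%:R * (h * e).
  apply: le_trans bound _; apply: (@le_trans _ _ (h * (S2 - S1))); first by lra.
  rewrite mulrCA ler_wpM2l ?(ltW h0) //; move: NS; rewrite ltr_pdivrMr // => NS.
  by apply: le_trans (ltW NS) _; rewrite ler_wpM2r ?(ltW e0) // ler_nat.
by rewrite ler_pM2l // in bound2.
Qed.

(** The variation of the right slopes of f at z is dominated by that of the
    monotone right slopes at a point b of [0, beta). *)
Lemma Sconv_slope_dom (R : realType) (n : nat) (beta z b : R) (f : R -> R) :
  (2 <= n)%N -> Sconv n beta%:E f -> `|z| <= b ->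
  forall h k, 0 < k -> k <= h -> b + h < beta ->
  `|(f (z + h) - f z) / h - (f (z + k) - f z) / k| <=
    (f (b + h) - f b) / h - (f (b + k) - f b) / k.
Proof.
move=> n2 hf zb h k k0 kh bh.
have h0 : 0 < h by exact: lt_le_trans kh.
have t01 : 0 <= k / h <= 1.
  by rewrite divr_ge0 ?ler_pdivrMr ?mul1r // ltW.
have xyE : `|z + h - z| = h by rewrite addrAC subrr add0r ger0_norm // ltW.
have := @Sconv_defect_le _ n beta f (z + h) z b (k / h) n2 hf t01 zb.
rewrite xyE => /(_ bh); rewrite /convdefect.
have hn0 : h != 0 by rewrite gt_eqF.
have kn0 : k != 0 by rewrite gt_eqF.
have E y : k / h * f (y + h) + (1 - k / h) * f y -
    f (k / h * (y + h) + (1 - k / h) * y) =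
    k * ((f (y + h) - f y) / h - (f (y + k) - f y) / k).
  have -> : k / h * (y + h) + (1 - k / h) * y = y + k by field.
  by field; rewrite hn0 kn0.
by rewrite !E normrM (gtr0_norm k0) ler_pM2l.
Qed.

(** The difference quotients satisfy Cauchy's criterion: those from the right by
    domination with the monotone, bounded below quotients at b, and those from
    the left because f has no kink at z. *)
Lemma Sconv_derivable (R : realType) (n : nat) (beta z : R) (f : R -> R) :
  (2 <= n)%N -> Sconv n beta%:E f -> `|z| < beta -> derivable f z 1.
Proof.
move=> n2 hf zb; have cf := Sconv_convex n2 hf.
pose r := (beta - `|z|) / 3.
have r0 : 0 < r by rewrite /r; lra.
have rE : beta = `|z| + 3 * r by rewrite /r; lra.
have zn := normr_ge0 z.
pose b := `|z| + r.
pose q h := (f (z + h) - f z) / h; pose Q h := (f (b + h) - f b) / h.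
pose E := [set Q h | h in [set h | 0 < h <= r]].
have E_inf : has_inf E.
  split; first by exists (Q r), r => //=; rewrite r0 lexx.
  exists ((f b - f 0) / (b - 0)) => _ [h /andP[h0 hr] <-].
  have -> : Q h = (f (b + h) - f b) / (b + h - b).
    by rewrite /Q (_ : b + h - b = h) //; ring.
  by apply: (convex_slope_le cf); rewrite /b ?rE; lra.
rewrite /derivable; apply/cauchy_cvgP; apply: cauchy_exP => e e0.
have e2 : 0 < e / 2 by rewrite divr_gt0.
have e4 : 0 < e / 4 by rewrite divr_gt0.
have [_ [h1 /andP[h10 h1r] <-] Qh1] := inf_adherent e2 E_inf.
have [h2 h20 sym] := Sconv_defect_bound n2 hf zb e4.
have right h : 0 < h -> h <= h1 -> `|q h1 - q h| < e / 2.
  move=> h0 hh1; apply: le_lt_trans (Sconv_slope_dom n2 hf (_ : `|z| <= b) h0 hh1 _) _.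
  - by rewrite /b; lra.
  - by rewrite /b rE; lra.
  rewrite -/(Q h1) -/(Q h).
  suff : inf E <= Q h by lra.
  apply: ge_inf; first by case: E_inf.
  by exists h => //=; rewrite h0 (le_trans hh1).
have left h : 0 < h -> h <= h2 -> `|q h - q (- h)| <= e / 4.
  move=> h0 hh2.
  have hn0 : h != 0 by rewrite gt_eqF.
  have -> : q h - q (- h) = (f (z + h) + f (z - h) - 2 * f z) / h.
    by rewrite /q; field.
  by rewrite normrM normfV (gtr0_norm h0) ler_pdivrMr // [e / 4 * h]mulrC sym // h0.
exists (q h1); apply/nbhs_ballP.
exists (Num.min h1 h2); first by rewrite /= lt_min h10.
move=> h /=; rewrite -!ball_normE /= sub0r normrN lt_min => /andP[hh1 hh2] hn0.
have -> : h^-1 *: (f (h%:A + z) - f z) = q h.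
  by rewrite /q -[LHS]/(h^-1 * (f (h * 1 + z) - f z)) mulr1 mulrC [h + z]addrC.
move: h hh1 hh2 hn0 => h hh1 hh2 hn0.
have [h0|h0|h0] := ltgtP (h : R) 0; last by rewrite h0 eqxx in hn0.
- rewrite (ltr0_norm h0) in hh1 hh2.
  have mh0 : 0 < - (h : R) by rewrite oppr_gt0.
  have L := left _ mh0 (ltW hh2); have := right _ mh0 (ltW hh1).
  rewrite opprK in L => R'.
  rewrite -[q h1](subrK (q (- h))) -addrA.
  by apply: le_lt_trans (ler_normD _ _) _; lra.
- rewrite (gtr0_norm h0) in hh1.
  by apply: lt_trans (right h h0 (ltW hh1)) _; lra.
Qed.

(** * Positivity, monotonicity and convexity of the derivative *)

Lemma Sconv_is_derive (R : realType) (n : nat) (beta z : R) (f : R -> R) :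
  (2 <= n)%N -> Sconv n beta%:E f -> `|z| < beta ->
  is_derive z 1 f (f^`()%classic z).
Proof.
move=> n2 hf zb; rewrite derive1E; apply: derivableP.
exact: Sconv_derivable hf zb.
Qed.

Lemma is_derive_affine (R : realType) (c x t d : R) (f : R -> R) :
  is_derive (c + t * x) 1 f d ->
  is_derive t 1 (fun s => f (c + s * x)) (d * x).
Proof.
move=> fd; apply: (@is_derive1_comp _ f (fun s => c + s * x)).
have -> : (fun s => c + s * x) = cst c + x \*: id.
  by apply/funext => s; rewrite -[RHS]/(c + x * s) mulrC.
by apply: is_derive_eq; rewrite add0r -[LHS]/(x * 1) mulr1.
Qed.

Lemma is_derive_entry_sum (R : realType) (n : nat) (f df : R -> R)
    (W B X : 'I_n -> 'I_n -> R) (t : R) :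
  (forall a b, is_derive (B a b + t * X a b) 1 f (df (B a b + t * X a b))) ->
  is_derive t 1 (fun s => \sum_a \sum_b W a b * f (B a b + s * X a b))
    (\sum_a \sum_b W a b * (df (B a b + t * X a b) * X a b)).
Proof.
move=> fd.
have -> : (fun s => \sum_a \sum_b W a b * f (B a b + s * X a b)) =
    \sum_a \sum_b (W a b \*: (fun s => f (B a b + s * X a b))).
  apply/funext => s; rewrite fct_sumE; apply: eq_bigr => a _.
  by rewrite fct_sumE.
apply: is_derive_sum => a; apply: is_derive_sum => b.
by apply: is_deriveZ; apply: is_derive_affine.
Qed.

Lemma derive_le_chord (R : realType) (rho : R -> R) (d c : R) :
  is_derive (0 : R) 1 rho d ->
  (forall t, 0 <= t <= 1 -> rho t <= rho 0 + t * c) -> d <= c.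
Proof.
move=> [drho <-] chord; rewrite leNgt; apply/negP => cd.
have near_gt := cvgr_gt _ drho _ cd.
have [e /= e0 He] : nbhs_ball (0 : R)
    [set h | h != 0 -> c < h^-1 *: ((rho \o shift 0) (h *: 1) - rho 0)].
  by apply/nbhs_ballP; apply: near_gt.
pose t := Num.min (e / 2) 1.
have t0 : 0 < t by rewrite lt_min divr_gt0 //=.
have te : t <= e / 2 by rewrite ge_min lexx.
have t1 : t <= 1 by rewrite ge_min lexx orbT.
have := He t; rewrite -ball_normE /= sub0r normrN gtr0_norm //.
have /[swap] /[apply] : t < e by lra.
move=> /(_ _)/wrap[]; first by rewrite gt_eqF.
rewrite -[X in c < X]/(t^-1 * (rho (t * 1 + 0) - rho 0)) mulr1 addr0 mulrC.
rewrite ltr_pdivlMr // => h.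
by have := chord t; rewrite (ltW t0) t1 => /(_ isT); lra.
Qed.

(** A function lying below its chord on [0, 1] has its derivatives at the ends on
    either side of the slope of the chord. *)
Lemma derive_ends_le (R : realType) (rho : R -> R) (d0 d1 : R) :
  is_derive (0 : R) 1 rho d0 -> is_derive (1 : R) 1 rho d1 ->
  (forall t, 0 <= t <= 1 -> rho t <= t * rho 1 + (1 - t) * rho 0) -> d0 <= d1.
Proof.
move=> D0 D1 chord.
apply: (@le_trans _ _ (rho 1 - rho 0)).
  by apply: (derive_le_chord D0) => t /chord; lra.
rewrite -lerN2 -mulrN1.
have D1' : is_derive (0 : R) 1 (fun s => rho (1 + s * -1)) (d1 * -1).
  by apply: is_derive_affine; rewrite mul0r addr0.
apply: (derive_le_chord D1') => t t01; rewrite mul0r addr0.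
by have := chord (1 + t * -1); rewrite (_ : 0 <= _ <= 1); [move/(_ isT); lra|lra].
Qed.

Lemma psdmx_add (R : realType) (n : nat) (A B : 'M[R]_n) :
  psdmx A -> psdmx B -> psdmx (A + B).
Proof.
move=> /psdmxP[sA pA] /psdmxP[sB pB]; apply/psdmxP; split.
  by rewrite /symmx linearD /= sA sB.
move=> x; under eq_bigr => a _ do under eq_bigr => b _ do rewrite mxE mulrDr.
under eq_bigr do rewrite big_split /=.
by rewrite big_split addr_ge0 //= ?pA ?pB.
Qed.

Lemma psdmx_gram (R : realType) (n : nat) (P : pred 'I_n) (d : 'I_n -> R)
    (U : 'M[R]_n) : (forall k, P k -> 0 <= d k) ->
  psdmx (\matrix_(a, b) \sum_(k | P k) d k * U k a * U k b).
Proof.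
move=> d0; apply/psdmxP; split.
  by apply/matrixP => a b; rewrite !mxE; apply: eq_bigr => k _; ring.
move=> x.
have -> : \sum_a \sum_b x a * x b *
    (\matrix_(a, b) \sum_(k | P k) d k * U k a * U k b) a b =
    \sum_(k | P k) d k * (\sum_a U k a * x a) ^+ 2.
  under eq_bigr => a _ do under eq_bigr => b _ do rewrite mxE mulr_sumr.
  under eq_bigr do rewrite exchange_big.
  rewrite exchange_big; apply: eq_bigr => k _ /=.
  rewrite expr2 mulr_suml mulr_sumr; apply: eq_bigr => a _.
  by rewrite !mulr_sumr; apply: eq_bigr => b _; ring.
by apply: sumr_ge0 => k /d0 dk; rewrite mulr_ge0 ?sqr_ge0.
Qed.

Lemma psd_entry_lt (R : realType) (n : nat) (A : 'M[R]_n) (beta : R) :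
  psdmx A -> (forall a, A a a < beta) -> forall a b, `|A a b| < beta.
Proof.
move=> pA dA a b; apply: le_lt_trans (psd_offdiag_le a b pA) _.
by have := dA a; have := dA b; lra.
Qed.

(** The quadratic form of f[B + s (A - B)] lies below its chord for s in [0, 1];
    the right-hand side is the difference of its derivatives at 1 and 0. *)
Lemma Sconv_derive_schur (R : realType) (n : nat) (beta : R) (f : R -> R)
    (A B : 'M[R]_n) (y : 'I_n -> R) :
  (2 <= n)%N -> Sconv n beta%:E f -> psdmx B -> psdmx (A - B) ->
  (forall a, A a a < beta) ->
  0 <= \sum_a \sum_b y a * y b *
    ((f^`()%classic (A a b) - f^`()%classic (B a b)) * (A a b - B a b)).
Proof.
move=> n2 hf pB pAB dA; pose g := f^`()%classic.
have pA : psdmx A by rewrite -(subrK B A); exact: psdmx_add.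
have dB a : B a a < beta.
  by apply: le_lt_trans (dA a); have := psd_diag_ge0 a pAB; rewrite !mxE subr_ge0.
have eA := psd_entry_lt pA dA; have eB := psd_entry_lt pB dB.
pose X a b := A a b - B a b.
pose rho s := \sum_a \sum_b (y a * y b) * f (B a b + s * X a b).
have D0 : is_derive (0 : R) 1 rho
    (\sum_a \sum_b (y a * y b) * (g (B a b + 0 * X a b) * X a b)).
  apply: is_derive_entry_sum => a b; apply: (Sconv_is_derive n2 hf).
  by rewrite mul0r addr0.
have D1 : is_derive (1 : R) 1 rho
    (\sum_a \sum_b (y a * y b) * (g (B a b + 1 * X a b) * X a b)).
  apply: is_derive_entry_sum => a b; apply: (Sconv_is_derive n2 hf).
  by rewrite mul1r /X addrC subrK.
have chord t : 0 <= t <= 1 -> rho t <= t * rho 1 + (1 - t) * rho 0.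
  move=> t01.
  have sA : symmx A by case: pA.
  have sB : symmx B by case: pB.
  have := hf A B sA sB _ _ pAB _ t t01.
  rewrite /loewner_le subr0 => H.
  have /psdmxP[_ /(_ y)] := H (fun a b => (in_itv_finP _ _).2 (eA a b))
     (fun a b => (in_itv_finP _ _).2 (eB a b)) pB.
  rewrite -[X in _ -> is_true X]subr_ge0; congr (0 <= _).
  rewrite /rho !mulr_sumr -big_split -sumrB /=; apply: eq_bigr => a _.
  rewrite !mulr_sumr -big_split -sumrB /=; apply: eq_bigr => b _.
  rewrite !mxE mul1r mul0r addr0 /X [B a b + (A a b - _)]addrC subrK.
  rewrite (_ : B a b + t * (A a b - B a b) = t * A a b + (1 - t) * B a b); last by ring.
  ring.
have := derive_ends_le D0 D1 chord; rewrite -subr_ge0 -sumrB.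
have -> : \sum_a \sum_b y a * y b * ((g (A a b) - g (B a b)) * (A a b - B a b)) =
   \sum_a (\sum_b (y a * y b) * (g (B a b + 1 * X a b) * X a b) -
     \sum_b (y a * y b) * (g (B a b + 0 * X a b) * X a b)).
  apply: eq_bigr => a _; rewrite -sumrB; apply: eq_bigr => b _.
  rewrite mul0r mul1r addr0 [B a b + _]addrC /X subrK; ring.
by [].
Qed.

(** When A - B = x x^T, the Schur factor is removed by testing with y a = z a / x a.
    Where x a or x b vanishes, A and B have the same entry, so that nothing is
    lost there. *)
Lemma Sconv_derive_rank1 (R : realType) (n : nat) (beta : R) (f : R -> R)
    (A B : 'M[R]_n) (x : 'I_n -> R) :
  (2 <= n)%N -> Sconv n beta%:E f -> psdmx B ->
  (forall a b, A a b = B a b + x a * x b) -> (forall a, A a a < beta) ->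
  psdmx (map_mx f^`()%classic A - map_mx f^`()%classic B).
Proof.
move=> n2 hf pB AE dA; have /psdmxP[sB _] := pB.
have ABE a b : (A - B) a b = x a * x b by rewrite !mxE AE addrC addKr.
have pAB : psdmx (A - B).
  apply/psdmxP; split; first by apply/matrixP => a b; rewrite mxE !ABE mulrC.
  move=> z; have -> : \sum_a \sum_b z a * z b * (A - B) a b =
      (\sum_a z a * x a) ^+ 2.
    rewrite expr2 mulr_suml; apply: eq_bigr => a _; rewrite mulr_sumr.
    by apply: eq_bigr => b _; rewrite ABE; ring.
  exact: sqr_ge0.
apply/psdmxP; split.
  by apply/matrixP => a b; rewrite !mxE !AE (symmxE sB b a) [x b * _]mulrC.
move=> z.
have := Sconv_derive_schur (fun a => z a / x a) n2 hf pB pAB dA.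
congr (0 <= _); apply: eq_bigr => a _; apply: eq_bigr => b _.
rewrite !mxE AE [B a b + _ - B a b]addrC addKr.
have [->|xa] := eqVneq (x a) 0; first by rewrite mul0r addr0 subrr mul0r !mulr0.
have [->|xb] := eqVneq (x b) 0; first by rewrite mulr0 addr0 subrr mul0r !mulr0.
by field; rewrite xa xb.
Qed.

(** Climb from B to A by the rank-one terms of the spectral decomposition of
    A - B; every intermediate matrix lies below A, hence keeps its diagonal, and
    then all its entries, below beta. *)
Lemma Sconv_derive_mono (R : realType) (n : nat) (beta : R) (f : R -> R)
    (A B : 'M[R]_n) :
  (2 <= n)%N -> Sconv n beta%:E f -> psdmx B -> psdmx (A - B) ->
  (forall a, A a a < beta) ->
  psdmx (map_mx f^`()%classic A - map_mx f^`()%classic B).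
Proof.
move=> n2 hf pB pAB dA; pose g := f^`()%classic.
have sAB : symmx (A - B) by case: pAB.
have [U UU ABE] := spectral_eigvals sAB.
pose d k := tnth (eigvals (A - B)) k.
have d0 k : 0 <= d k by exact: eigvals_ge0.
pose G (P : pred 'I_n) : 'M[R]_n :=
  \matrix_(a, b) \sum_(k | P k) d k * U k a * U k b.
have pG P : psdmx (G P) by exact: psdmx_gram.
pose C j := B + G (fun k : 'I_n => (k < j)%N).
have CA j : A = C j + G (fun k : 'I_n => ~~ (k < j)%N).
  rewrite -[LHS](subrK B) addrC -addrA; congr (_ + _); apply/matrixP => a b.
  by rewrite ABE !mxE (bigID (fun k : 'I_n => (k < j)%N)).
have pC j : psdmx (C j) by exact: psdmx_add.
have dC j a : C j a a < beta.
  apply: le_lt_trans (dA a); rewrite [in X in _ <= X](CA j) [X in _ <= X]mxE lerDl.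
  exact: psd_diag_ge0.
have CS (k : 'I_n) a b :
    C k.+1 a b = C k a b + (Num.sqrt (d k) * U k a) * (Num.sqrt (d k) * U k b).
  rewrite !mxE -addrA; congr (_ + _).
  rewrite (bigD1 k) //= addrC; congr (_ + _).
    by apply: eq_bigl => l; rewrite ltnS [in RHS]ltn_neqAle andbC.
  by rewrite mulrACA -expr2 sqr_sqrtr // mulrA.
have main j : (j <= n)%N -> psdmx (map_mx g (C j) - map_mx g B).
  elim: j => [|j IH] jn.
    have -> : C 0%N = B.
      by apply/matrixP => a b; rewrite !mxE big_pred0 ?addr0.
    rewrite subrr; apply/psdmxP; split; first exact: trmx0.
    by move=> x; rewrite sumr_ge0 // => a _; rewrite sumr_ge0 // => b _;
      rewrite mxE mulr0.
  rewrite -(subrK (map_mx g (C j)) (map_mx g (C j.+1))) -addrA.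
  apply: psdmx_add; last exact/IH/ltnW.
  exact: (Sconv_derive_rank1 n2 hf (pC j) (CS (Ordinal jn))).
have -> : A = C n.
  rewrite [LHS](CA n); apply/matrixP => a b; rewrite mxE [X in _ + X]mxE.
  by rewrite big_pred0 ?addr0 // => k; rewrite ltn_ord.
exact: main.
Qed.

(** By [Sconv_defect_le] the difference f (x + s) - f x is convex in x for every
    s >= 0, and f' is the limit of these differences divided by s. *)
Lemma Sconv_derive_convex (R : realType) (n : nat) (beta : R) (f : R -> R) :
  (2 <= n)%N -> Sconv n beta%:E f -> convex_below beta f^`()%classic.
Proof.
move=> n2 hf; set g := f^`()%classic.
apply: convex_below_of_defect => x w t x0 xw wb t01.
have /andP[t0 t1] := t01.
pose y := t * w + (1 - t) * x.
have x_lt : `|x| < beta by rewrite ger0_norm // (lt_trans xw).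
have w_lt : `|w| < beta by rewrite ger0_norm // (le_trans x0 (ltW xw)).
have y_lt : `|y| < beta.
  have twx : 0 <= t * (w - x) by rewrite mulr_ge0 //; lra.
  have twx' : 0 <= (1 - t) * (w - x) by rewrite mulr_ge0 //; lra.
  by rewrite ger0_norm /y; lra.
pose r := (beta - w) / 2.
have r0 : 0 < r by rewrite divr_gt0 ?subr_gt0.
pose F z := fun s : R => f (z + s * r).
have DF z : `|z| < beta -> is_derive (0 : R) 1 (F z) (g z * r).
  move=> zb; apply: is_derive_affine; rewrite mul0r addr0.
  exact: (Sconv_is_derive n2 hf).
(* -rho s is the convexity defect of f at the pair w + s r, x + s r. *)
pose rho := F y - (t \*: F w + (1 - t) \*: F x).
have Drho : is_derive (0 : R) 1 rho (g y * r - (t * (g w * r) + (1 - t) * (g x * r))).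
  have Dx := DF x x_lt; have Dw := DF w w_lt; have Dy := DF y y_lt.
  by apply: is_derive_eq.
have : g y * r - (t * (g w * r) + (1 - t) * (g x * r)) <= 0.
  apply: (derive_le_chord Drho) => s /andP[s0 s1]; rewrite mulr0 addr0.
  have sr : s * r <= r by rewrite ler_piMl // ltW.
  have sr0 : 0 <= s * r by rewrite mulr_ge0 // ltW.
  have wxE : `|w - x| = w - x by rewrite ger0_norm // subr_ge0 ltW.
  have := @Sconv_defect_le _ n beta f w x (x + s * r) t n2 hf t01.
  rewrite wxE (_ : x + s * r + (w - x) = w + s * r); last by ring.
  rewrite (ger0_norm x0) lerDl => /(_ sr0 _)/(le_trans (ler_norm _)) H.
  have /H : w + s * r < beta by rewrite /r in sr *; lra.
  rewrite /convdefect.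
  rewrite (_ : t * (w + s * r) + (1 - t) * (x + s * r) = y + s * r); last first.
    by rewrite /y; ring.
  rewrite -/y -[rho s]/(f (y + s * r) - (t * f (w + s * r) + (1 - t) * f (x + s * r))).
  rewrite -[rho 0]/(f (y + 0 * r) - (t * f (w + 0 * r) + (1 - t) * f (x + 0 * r))).
  by rewrite !mul0r !addr0; lra.
rewrite (_ : _ - _ = - (r * convdefect g w x t)); last by rewrite /convdefect; ring.
by rewrite oppr_le0 pmulr_rge0.
Qed.

Lemma Sconv_derive_nondecreasing (R : realType) (n : nat) (beta : R) (f : R -> R) :
  (2 <= n)%N -> Sconv n beta%:E f ->
  forall x y, 0 <= x -> x <= y -> y < beta ->
  f^`()%classic x <= f^`()%classic y.
Proof.
move=> n2 hf x y x0 xy yb.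
have [i0 [i1 _]] := exists_other_ord n2.
pose A := twolevel i0 y y; pose B := twolevel i0 x x.
have pB : psdmx B by apply: psd_twolevel; rewrite ger0_norm.
have pAB : psdmx (A - B).
  rewrite (_ : A - B = twolevel i0 (y - x) (y - x)).
    by apply: psd_twolevel; rewrite ger0_norm ?subr_ge0.
  by apply/matrixP => i j; rewrite !mxE; case: ifP.
have dA a : A a a < beta by rewrite mxE; case: ifP.
have := psd_diag_ge0 i0 (Sconv_derive_mono n2 hf pB pAB dA).
by rewrite !mxE eqxx subr_ge0.
Qed.

Lemma Sconv_derive_psd (R : realType) (n : nat) (beta : R) (f : R -> R)
    (A : 'M[R]_n) :
  (2 <= n)%N -> Sconv n beta%:E f -> 0 <= f^`()%classic 0 -> psdmx A ->
  (forall a, A a a < beta) -> psdmx (map_mx f^`()%classic A).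
Proof.
move=> n2 hf f0 pA dA.
have [i0 [i1 _]] := exists_other_ord n2.
have p0 : psdmx (twolevel i0 (0 : R) 0) by apply: psd_twolevel; rewrite normr0.
have E0 : twolevel i0 (0 : R) 0 = 0 by apply/matrixP => i j; rewrite !mxE if_same.
have pg0 : psdmx (map_mx f^`()%classic (twolevel i0 (0 : R) 0)).
  rewrite (_ : map_mx _ _ = twolevel i0 (f^`()%classic 0) (f^`()%classic 0)).
    by apply: psd_twolevel; rewrite ger0_norm.
  by apply/matrixP => i j; rewrite !mxE !if_same.
rewrite -[X in psdmx X](subrK (map_mx f^`()%classic (twolevel i0 (0 : R) 0))).
apply: psdmx_add pg0; apply: (Sconv_derive_mono n2 hf p0 _ dA).
by rewrite E0 subr0.
Qed.

(** The right derivative of g, defined as the infimum of the slopes to the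
    right. *)
Lemma convex_subgradient (R : realType) (beta : R) (g : R -> R) :
  convex_below beta g ->
  (forall x y, 0 <= x -> x <= y -> y < beta -> g x <= g y) ->
  let D := [set x | 0 <= x < beta] in
  exists h : R -> R, [/\ forall x y, D x -> D y -> g x + h x * (y - x) <= g y,
    forall x, D x -> 0 <= h x &
    forall x y, D x -> D y -> x <= y -> h x <= h y].
Proof.
move=> cg gmon D.
pose E x := [set (g y - g x) / (y - x) | y in [set y | x < y < beta]].
pose h x := inf (E x).
have E0 x : D x -> E x !=set0.
  move=> /andP[x0 xb]; exists ((g ((x + beta) / 2) - g x) / ((x + beta) / 2 - x)).
  by exists ((x + beta) / 2) => //=; lra.
have slope_ge0 x y : 0 <= x -> x < y -> y < beta -> 0 <= (g y - g x) / (y - x).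
  by move=> x0 xy yb; rewrite divr_ge0 ?subr_ge0 ?gmon // ltW.
have Elb x : D x -> has_lbound (E x).
  move=> /andP[x0 xb]; exists 0 => _ [y /andP[xy yb] <-]; exact: slope_ge0.
have h_le x y : D x -> x < y -> y < beta -> h x <= (g y - g x) / (y - x).
  by move=> Dx xy yb; apply: ge_inf (Elb x Dx) _ _; exists y => //=; rewrite xy.
have h_ge x y : D x -> 0 <= y -> y < x -> (g x - g y) / (x - y) <= h x.
  move=> Dx y0 yx; apply: lb_le_inf; first exact: E0.
  by move=> _ [z /andP[xz zb] <-]; exact: (convex_slope_le cg).
exists h; split.
- move=> x y Dx Dy; have /andP[x0 xb] := Dx; have /andP[y0 yb] := Dy.
  have [xy|yx|->] := ltgtP x y; last by rewrite subrr mulr0 addr0.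
    by have := h_le x y Dx xy yb; rewrite ler_pdivlMr ?subr_gt0 //; lra.
  by have := h_ge x y Dx y0 yx; rewrite ler_pdivrMr ?subr_gt0 //; lra.
- move=> x Dx; apply: lb_le_inf; first exact: E0.
  by have /andP[x0 xb] := Dx; move=> _ [y /andP[xy yb] <-]; exact: slope_ge0.
- move=> x y Dx Dy; rewrite le_eqVlt => /orP[/eqP->//|xy].
  have /andP[x0 xb] := Dx; have /andP[y0 yb] := Dy.
  exact: le_trans (h_le x y Dx xy yb) (h_ge y x Dy x0 xy).
Qed.

(** * Weak majorization *)

Lemma sum_perm_initial (R : realType) (n m : nat) (p : {perm 'I_n})
    (F : 'I_n -> R) :
  \sum_a ((p^-1)%g a < m)%N%:R * F a = \sum_(i < n | (i < m)%N) F (p i).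
Proof.
rewrite (reindex_inj (@perm_inj _ p)) [RHS]big_mkcond /=.
by apply: eq_bigr => i _; rewrite permK; case: ifP; rewrite ?mul1r ?mul0r.
Qed.

Lemma sum_perm_initial1 (R : realType) (n m : nat) (p : {perm 'I_n}) :
  (m <= n)%N -> \sum_a ((p^-1)%g a < m)%N%:R = m%:R :> R.
Proof.
move=> mn; transitivity (\sum_a ((p^-1)%g a < m)%N%:R * (1 : R)).
  by apply: eq_bigr => a _; rewrite mulr1.
by rewrite (sum_perm_initial m p (fun=> 1)) sum_indicator_ord.
Qed.

Lemma bool01 (R : realType) (b : bool) : 0 <= (b%:R : R) <= 1.
Proof. by case: b; rewrite !lexx ler01. Qed.

Lemma exists_decreasing_perm (R : realType) (n : nat) (c : 'I_n -> R) :
  exists p : {perm 'I_n}, forall i j : 'I_n, (i <= j)%N -> c (p j) <= c (p i).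
Proof.
pose t := [tuple c i | i < n].
have : perm_eq (sort >=%R t) t by rewrite perm_sort.
move=> /tuple_permP[p Ep]; exists p => i j ij.
have cE k : c (p k) = (sort >=%R t)`_k.
  by rewrite Ep -tnth_nth !tnth_mktuple.
have sz : size (sort >=%R t) = n by rewrite size_sort size_tuple.
rewrite !cE; apply: sorted_nth_le; last by rewrite ij sz /=.
by apply: sort_sorted => x y; exact: le_total.
Qed.

Lemma sum_le_sort (R : realType) (n m : nat) (b : n.-tuple R) : (m <= n)%N ->
  \sum_(i < m) b`_i <= \sum_(i < m) (sort >=%R b)`_i.
Proof.
move=> mn; set s := sort _ _.
have sz : size s == n by rewrite size_sort size_tuple.
have : perm_eq b (Tuple sz) by rewrite perm_sym perm_sort.
move=> /tuple_permP[p Ep].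
have bE (i : 'I_n) : b`_i = s`_(p i) by rewrite Ep -tnth_nth tnth_mktuple (tnth_nth 0).
rewrite (sum_ord_cond _ mn); under eq_bigr do rewrite bE.
rewrite -(sum_perm_initial m p (fun a => s`_a)).
have [th thE] := ord_fun_extend (fun a : 'I_n => ((p^-1)%g a < m)%N%:R : R).
under eq_bigr do rewrite -thE.
apply: (weighted_sum_le_top (s := fun a => s`_a)) => //.
- move=> i j ij; apply: sorted_nth_le; last by rewrite (eqP sz).
  by apply: sort_sorted => x y; exact: le_total.
- by move=> i ni; rewrite (thE (Ordinal ni)) bool01.
- by under eq_bigr do rewrite thE; exact: sum_perm_initial1.
Qed.

(** After sorting c, the weighted sum of the g (c a) is at most the sum over the j
    largest entries, and [karamata_weak] compares that sum with gam. *)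
Lemma topsum_dominates_convex (R : realType) (n : nat) (beta : R) (g : R -> R)
    (gam : nat -> R) (c : 'I_n -> R) :
  convex_below beta g ->
  (forall x y, 0 <= x -> x <= y -> y < beta -> g x <= g y) ->
  (forall a, 0 <= c a < beta) -> (forall i, (i < n)%N -> 0 <= gam i < beta) ->
  topsum_dominates gam c -> topsum_dominates (g \o gam) (g \o c).
Proof.
move=> cg gmon cb gamb dom j theta jn th01 thj.
have [h [hsub h0 hmon]] := convex_subgradient cg gmon.
have [p pdec] := exists_decreasing_perm c.
have [cs csE] := ord_fun_extend (fun i => c (p i)).
have [th thE] := ord_fun_extend (fun i => theta (p i)).
have csdec i k : (i <= k < n)%N -> cs k <= cs i.
  move=> /andP[ik kn]; have ni := leq_ltn_trans ik kn.
  by rewrite (csE (Ordinal kn)) (csE (Ordinal ni)) pdec.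
have csb i : (i < n)%N -> 0 <= cs i < beta.
  by move=> ni; rewrite (csE (Ordinal ni)) cb.
rewrite (reindex_inj (@perm_inj _ p)) /=.
apply: (@le_trans _ _ (\sum_(i < n) th i * g (cs i))).
  by apply: ler_sum => i _; rewrite thE csE.
apply: (@le_trans _ _ (\sum_(i < j) g (cs i))).
  apply: (weighted_sum_le_top (s := g \o cs)) => //.
  - move=> i k ik; have /andP[ik' kn] := ik.
    have /andP[k0 _] := csb k kn.
    have /andP[_ ib] := csb i (leq_ltn_trans ik' kn).
    by apply: gmon => //; exact: csdec.
  - by move=> i ni; rewrite (thE (Ordinal ni)).
  - rewrite -thj [RHS](reindex_inj (@perm_inj _ p)) /=.
    by apply: eq_bigr => i _; rewrite thE.
apply: (karamata_weak (D := [set x | 0 <= x < beta]) hsub h0 hmon).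
- by move=> i ij; apply: csb; exact: leq_trans jn.
- by move=> i ij; apply: gamb; exact: leq_trans jn.
- by move=> i k /andP[ik kj]; apply: csdec; rewrite ik (leq_trans kj).
- move=> k kj; have kn := leq_trans kj jn.
  rewrite (sum_ord_cond cs kn); under eq_bigr do rewrite csE.
  rewrite -(sum_perm_initial k p c); apply: dom => //.
    by move=> a; exact: bool01.
  exact: sum_perm_initial1.
Qed.

Lemma orthomx_weight (R : realType) (n : nat) (U : 'M[R]_n) (theta : 'I_n -> R) :
  orthomx U -> (forall a, 0 <= theta a <= 1) ->
  (forall k, 0 <= \sum_a theta a * U k a ^+ 2 <= 1) /\
  \sum_k \sum_a theta a * U k a ^+ 2 = \sum_a theta a.
Proof.
move=> UU th01; split=> [k|].
  apply/andP; split.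
    by apply: sumr_ge0 => a _; rewrite mulr_ge0 ?sqr_ge0 //; case/andP: (th01 a).
  have <- : \sum_a U k a ^+ 2 = 1.
    by under eq_bigr do rewrite expr2; rewrite (orthomx_row UU) eqxx.
  by apply: ler_sum => a _; rewrite ler_piMl ?sqr_ge0 //; case/andP: (th01 a).
rewrite exchange_big; apply: eq_bigr => a _; rewrite -mulr_sumr.
by under eq_bigr do rewrite expr2; rewrite (orthomx_col UU) eqxx mulr1.
Qed.

(** Schur's theorem: a weighted sum of the diagonal of A is a weighted sum of its
    eigenvalues, with weights again in [0, 1] and of the same total. *)
Lemma eigvals_dominate_diag (R : realType) (n : nat) (A : 'M[R]_n) : symmx A ->
  topsum_dominates (fun i => (eigvals A)`_i) (fun a => A a a).
Proof.
move=> sA j theta jn th01 thj; have [U UU AE] := spectral_eigvals sA.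
have [xi01 xisum] := orthomx_weight UU th01.
have [xi xiE] := ord_fun_extend (fun k => \sum_a theta a * U k a ^+ 2).
have -> : \sum_a theta a * A a a = \sum_(k < n) xi k * (eigvals A)`_k.
  under eq_bigr do rewrite AE mulr_sumr.
  rewrite exchange_big; apply: eq_bigr => k _; rewrite xiE mulr_suml.
  by apply: eq_bigr => a _; rewrite (tnth_nth 0); ring.
apply: (weighted_sum_le_top (s := fun k => (eigvals A)`_k)) => //.
- exact: eigvals_dec.
- by move=> i ni; rewrite (xiE (Ordinal ni)).
- by under eq_bigr do rewrite xiE; rewrite xisum.
Qed.

Lemma diag_le_opnorm (R : realType) (n : nat) (A : 'M[R]_n) a : symmx A ->
  A a a <= opnorm A.
Proof.
move=> sA; have [U UU AE] := spectral_eigvals sA.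
have <- : \sum_k opnorm A * U k a ^+ 2 = opnorm A.
  rewrite -mulr_sumr; under eq_bigr do rewrite expr2.
  by rewrite (orthomx_col UU) eqxx mulr1.
rewrite AE; apply: ler_sum => k _.
by rewrite -mulrA -expr2 ler_wpM2r ?sqr_ge0 ?eigvals_le_opnorm.
Qed.

(** * Comparison of increments along the segment *)

(** A primitive in t of f' (b + t (a - b)) whose increment over [0, 1] is the
    divided difference, including in the case a = b. *)
Definition segment_antiderivative (R : realType) (f : R -> R) (a b t : R) : R :=
  if a == b then t * f^`()%classic a else f (b + t * (a - b)) / (a - b).

Lemma segment_antiderivative_diff (R : realType) (f : R -> R) (a b : R) :
  segment_antiderivative f a b 1 - segment_antiderivative f a b 0 =
  divdiff f a b.
Proof.
rewrite /segment_antiderivative /divdiff; case: eqP => _.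
  by rewrite mul1r mul0r subr0.
by rewrite mul1r mul0r addr0 [b + _]addrC subrK mulrBl.
Qed.

Lemma is_derive_segment_antiderivative (R : realType) (f : R -> R) (a b t : R) :
  is_derive (b + t * (a - b)) 1 f (f^`()%classic (b + t * (a - b))) ->
  is_derive t 1 (segment_antiderivative f a b) (f^`()%classic (b + t * (a - b))).
Proof.
rewrite /segment_antiderivative; case: eqP => [->|/eqP ab] Df.
  have -> : (fun s => s * f^`()%classic b) = f^`()%classic b \*: id.
    by apply/funext => s; rewrite mulrC.
  apply: is_derive_eq; rewrite subrr mulr0 addr0.
  by rewrite -[LHS]/(_ * 1) mulr1.
have ab0 : a - b != 0 by rewrite subr_eq0.
have -> : (fun s => f (b + s * (a - b)) / (a - b)) =
    (a - b)^-1 \*: (fun s => f (b + s * (a - b))).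
  by apply/funext => s; rewrite mulrC.
have D := is_derive_affine Df.
apply: is_derive_eq.
by rewrite -[LHS]/((a - b)^-1 * (_ * (a - b))) mulrCA mulVf // mulr1.
Qed.

Lemma increment_le (R : realType) (phi psi dphi dpsi : R -> R) :
  (forall t : R, 0 <= t <= 1 -> is_derive t 1 phi (dphi t)) ->
  (forall t : R, 0 <= t <= 1 -> is_derive t 1 psi (dpsi t)) ->
  (forall t : R, 0 <= t <= 1 -> dphi t <= dpsi t) ->
  phi 1 - phi 0 <= psi 1 - psi 0.
Proof.
move=> Dphi Dpsi le_d.
have D (t : R) : 0 <= t <= 1 -> is_derive t 1 (psi - phi) (dpsi t - dphi t).
  by move=> t01; have Ds := Dpsi t t01; have Dh := Dphi t t01; exact: is_deriveB.
have [c c01] : exists2 c, c \in `[(0 : R), 1] &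
    (psi - phi) 1 - (psi - phi) 0 = (dpsi c - dphi c) * (1 - 0).
  apply: (@MVT_segment _ (psi - phi) (fun t => dpsi t - dphi t)) => //.
    by move=> t; rewrite inE /= => /andP[t0 t1]; apply: D; rewrite !ltW.
  apply: derivable_within_continuous => t; rewrite inE /= => t01.
  by have [] := D t t01.
have c01' : 0 <= c <= 1 by rewrite inE in c01.
have := le_d c c01'; rewrite -[(psi - phi) 1]/(psi 1 - phi 1).
rewrite -[(psi - phi) 0]/(psi 0 - phi 0); lra.
Qed.

Lemma convex_comb_lt (R : realType) (x y c t : R) : 0 <= t <= 1 ->
  x < c -> y < c -> t * x + (1 - t) * y < c.
Proof.
move=> /andP[t0 t1] xc yc.
have [->|tn0] := eqVneq t 0; first by lra.
have tp : 0 < t by rewrite lt_neqAle eq_sym tn0.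
have : t * x < t * c by rewrite ltr_pM2l.
have : (1 - t) * y <= (1 - t) * c by apply: ler_wpM2l; lra.
lra.
Qed.

Lemma convex_comb_ge0 (R : realType) (x y t : R) : 0 <= t <= 1 ->
  0 <= x -> 0 <= y -> 0 <= t * x + (1 - t) * y.
Proof. by move=> /andP[t0 t1] x0 y0; rewrite addr_ge0 // mulr_ge0 // subr_ge0. Qed.

Lemma psdmx_scale (R : realType) (n : nat) (A : 'M[R]_n) (t : R) :
  0 <= t -> psdmx A -> psdmx (t *: A).
Proof.
move=> t0 /psdmxP[sA pA]; apply/psdmxP; split; first by rewrite /symmx linearZ /= sA.
move=> x; have -> : \sum_a \sum_b x a * x b * (t *: A) a b =
    t * \sum_a \sum_b x a * x b * A a b.
  rewrite mulr_sumr; apply: eq_bigr => a _; rewrite mulr_sumr.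
  by apply: eq_bigr => b _; rewrite mxE; ring.
by rewrite mulr_ge0.
Qed.

(** The eigenvectors V and the signs eps of f[A] - f[B] are fixed once and for
    all, so that only f[C_t] depends on t in phi. *)
Lemma ky_fan_entrywise (R : realType) (n : nat) (beta : R) (f : R -> R)
    (A B : 'M[R]_n) (m : nat) :
  (2 <= n)%N -> Sconv n beta%:E f -> 0 <= f^`()%classic 0 ->
  psdmx A -> psdmx B -> opnorm A < beta -> opnorm B < beta -> (m <= n)%N ->
  \sum_(i < m) (singvals (map_mx f A - map_mx f B))`_i <=
  \sum_(i < m) (singvals (A - B))`_i *
    divdiff f (eigvals A)`_i (eigvals B)`_i.
Proof.
move=> n2 hf f0 pA pB nA nB mn.
have [sA _] := pA; have [sB _] := pB.
pose g := f^`()%classic.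
pose la i := (eigvals A)`_i; pose lb i := (eigvals B)`_i.
have la_b i : (i < n)%N -> 0 <= la i < beta.
  move=> ni; have := eigvals_ge0 pA (Ordinal ni).
  have := eigvals_le_opnorm sA (Ordinal ni); rewrite (tnth_nth 0) /= -/(la i).
  by move=> h1 ->; exact: le_lt_trans nA.
have lb_b i : (i < n)%N -> 0 <= lb i < beta.
  move=> ni; have := eigvals_ge0 pB (Ordinal ni).
  have := eigvals_le_opnorm sB (Ordinal ni); rewrite (tnth_nth 0) /= -/(lb i).
  by move=> h1 ->; exact: le_lt_trans nB.
pose C t := t *: A + (1 - t) *: B.
pose gam t i := t * la i + (1 - t) * lb i.
have gam_b t i : 0 <= t <= 1 -> (i < n)%N -> 0 <= gam t i < beta.
  move=> t01 ni; have /andP[a0 ab] := la_b i ni; have /andP[b0 bb] := lb_b i ni.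
  by rewrite convex_comb_ge0 ?convex_comb_lt.
have pC t : 0 <= t <= 1 -> psdmx (C t).
  by move=> /andP[t0 t1]; apply: psdmx_add; apply: psdmx_scale; rewrite ?subr_ge0.
have dC t a : 0 <= t <= 1 -> C t a a < beta.
  move=> t01; rewrite !mxE convex_comb_lt //.
    exact: le_lt_trans (diag_le_opnorm a sA) nA.
  exact: le_lt_trans (diag_le_opnorm a sB) nB.
have domC t : 0 <= t <= 1 -> topsum_dominates (gam t) (fun a => C t a a).
  move=> /andP[t0 t1] j theta jn th01 thj.
  have hA := eigvals_dominate_diag sA jn th01 thj.
  have hB := eigvals_dominate_diag sB jn th01 thj.
  have -> : \sum_a theta a * C t a a =
      t * (\sum_a theta a * A a a) + (1 - t) * (\sum_a theta a * B a a).
    rewrite !mulr_sumr -big_split; apply: eq_bigr => a _; rewrite !mxE /=; ring.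
  rewrite big_split -!mulr_sumr /=.
  by apply: lerD; apply: ler_wpM2l; rewrite ?subr_ge0.
have domg t : 0 <= t <= 1 ->
    topsum_dominates (g \o gam t) (fun a => map_mx g (C t) a a).
  move=> t01 j theta jn th01 thj.
  have cb a : 0 <= C t a a < beta by rewrite psd_diag_ge0 ?dC //; exact: pC.
  have := topsum_dominates_convex (Sconv_derive_convex n2 hf)
    (Sconv_derive_nondecreasing n2 hf) cb (fun i => gam_b t i t01) (domC t t01)
    jn th01 thj.
  by under [in X in _ -> X]eq_bigr do rewrite mxE.
have sX : symmx (A - B) by rewrite /symmx linearB /= sA sB.
have [U [mu [UU XE muE]]] := spectral_singvals sX.
have sZ : symmx (map_mx f A - map_mx f B).
  by rewrite /symmx linearB /= !map_trmx sA sB.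
have [V [nu [VV ZE nuE]]] := spectral_singvals sZ.
pose sig i := (singvals (A - B))`_i.
pose eps i := Num.sg (nu i).
have eps1 i : `|eps i| <= 1 by rewrite normr_sg; case: eqP; rewrite ?lexx ?ler01.
pose X a c := A a c - B a c.
(* The sum of the first m singular values of Z is the trace of Z W. *)
pose W a c := \sum_(i < n | (i < m)%N) eps i * V i a * V i c.
have Wsum (F : 'I_n -> 'I_n -> R) : \sum_a \sum_c W a c * F a c =
    \sum_(i < n | (i < m)%N) eps i * \sum_a \sum_c V i a * V i c * F a c.
  under [RHS]eq_bigr do rewrite mulr_sumr.
  rewrite [RHS]exchange_big; apply: eq_bigr => a _ /=.
  under [RHS]eq_bigr do rewrite mulr_sumr.
  rewrite [RHS]exchange_big; apply: eq_bigr => c _ /=.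
  by rewrite mulr_suml; apply: eq_bigr => i _; ring.
pose phi s := \sum_a \sum_c W a c * f (B a c + s * X a c).
pose psi s := \sum_(i < m) sig i * segment_antiderivative f (la i) (lb i) s.
have phiE : phi 1 - phi 0 = \sum_(i < m) (singvals (map_mx f A - map_mx f B))`_i.
  rewrite (sum_ord_cond (fun i => (singvals (map_mx f A - map_mx f B))`_i) mn).
  transitivity (\sum_a \sum_c W a c * (map_mx f A - map_mx f B) a c).
    rewrite /phi -sumrB; apply: eq_bigr => a _; rewrite -sumrB.
    apply: eq_bigr => c _; rewrite !mxE mul1r mul0r addr0 /X.
    by rewrite [B a c + _]addrC subrK mulrBr.
  rewrite Wsum; apply: eq_bigr => i _.
  by rewrite (rayleigh_eigenvector i VV ZE) -normrEsg nuE (tnth_nth 0).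
have psiE : psi 1 - psi 0 = \sum_(i < m) sig i * divdiff f (la i) (lb i).
  rewrite /psi -sumrB; apply: eq_bigr => i _.
  by rewrite -mulrBr segment_antiderivative_diff.
rewrite -phiE -[X in _ <= X]psiE.
have CE t a c : B a c + t * X a c = C t a c by rewrite !mxE /X; ring.
have gamE t i : lb i + t * (la i - lb i) = gam t i by rewrite /gam; ring.
apply: (@increment_le _ phi psi
  (fun t => \sum_a \sum_c W a c * (g (B a c + t * X a c) * X a c))
  (fun t => \sum_(i < m) sig i * g (gam t i))) => t t01.
- apply: is_derive_entry_sum => a c; apply: (Sconv_is_derive n2 hf).
  by rewrite CE; apply: psd_entry_lt; [exact: pC|move=> b; exact: dC].
- have -> : psi = \sum_(i < m) (sig i \*: segment_antiderivative f (la i) (lb i)).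
    by apply/funext => s; rewrite fct_sumE.
  apply: is_derive_sum => i; apply: is_deriveZ.
  have ni : (i < n)%N by exact: leq_trans (ltn_ord i) mn.
  rewrite -gamE; apply: is_derive_segment_antiderivative.
  apply: (Sconv_is_derive n2 hf); rewrite gamE.
  by have /andP[g0 gb] := gam_b t i t01 ni; rewrite ger0_norm.
- rewrite Wsum.
  have psdP := Sconv_derive_psd n2 hf f0 (pC t t01) (fun a => dC t a t01).
  have := schur_singular_le mn psdP UU VV XE eps1 _ _ (domg t t01).
  move=> /(_ sig) H; apply: le_trans (H _ _).
  + rewrite le_eqVlt; apply/orP; left; apply/eqP; apply: eq_bigr => i _.
    congr (_ * _); apply: eq_bigr => a _; apply: eq_bigr => c _.
    by rewrite CE !mxE.
  + by move=> k; rewrite muE (tnth_nth 0).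
  + move=> i j ij; apply: sorted_nth_le; first exact: singvals_sorted.
    by rewrite size_tuple.
Qed.

Theorem theorem6p3 (R : realType) (alpha : \bar R) (halpha : (0 < alpha)%E)
    (n : nat) (hn : (2 <= n)%N) (f : R -> R) (hf : Sconv n alpha f)
    (hf0 : 0 <= f^`()%classic 0) (A B : 'M[R]_n)
    (hA : psdmx A) (hB : psdmx B)
    (hnA : ((opnorm A)%:E < alpha)%E) (hnB : ((opnorm B)%:E < alpha)%E) :
  weakmaj (singvals (map_mx f A - map_mx f B))
          (hadamard (divdiff_tuple f (eigvals A) (eigvals B))
                    (singvals (A - B))).
Proof.
have [beta [ba nA nB]] : exists beta : R,
    [/\ (beta%:E <= alpha)%E, opnorm A < beta & opnorm B < beta].
  case: alpha halpha hf hnA hnB => [r| |] //.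
    by rewrite !lte_fin => _ _ nA nB; exists r.
  move=> _ _ _ _; exists (Num.max (opnorm A) (opnorm B) + 1).
  split; first exact: leey.
    by rewrite (@le_lt_trans _ _ (Num.max (opnorm A) (opnorm B))) ?ltrDl // le_max lexx.
  by rewrite (@le_lt_trans _ _ (Num.max (opnorm A) (opnorm B))) ?ltrDl // le_max lexx orbT.
have {}hf := Sconv_restrict ba hf.
move=> k /andP[_ kn].
rewrite (sorted_sort (@ge_trans R) (singvals_sorted _)).
apply: le_trans (ky_fan_entrywise hn hf hf0 hA hB nA nB kn) _.
apply: le_trans (sum_le_sort _ kn).
rewrite le_eqVlt; apply/orP; left; apply/eqP; apply: eq_bigr => i _.
pose j := Ordinal (leq_trans (ltn_ord i) kn).
rewrite -[i : nat]/(j : nat) -!tnth_nth !tnth_mktuple mulrC.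
by rewrite !(tnth_nth 0).
Qed.
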